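(* Let $n\ge 1$ and let $\psi\colon\mathbb H^n\to\mathbb R$ be a positive smooth function such that $\log\psi$ is a Kähler potential of $\omega_{\mathbb H^n}$ and $\|\partial\log\psi\|_{\omega_{\mathbb H^n}}$ is constant on $\mathbb H^n$. Then, up to the isotropy subgroup of $\mathbb H^n$ at $(0,\dots,0,1)$, $\log\psi$ is the canonical potential of $\mathbb H^n$; that is, there exist a holomorphic automorphism $\sigma$ of $\mathbb H^n$ with $\sigma(0,\dots,0,1)=(0,\dots,0,1)$ and a constant $r>0$ such that $\psi=r\,\psi_0\circ\sigma$ on $\mathbb H^n$.
   Context: $\mathbb H^n=\{w=(w',w_n)\in\mathbb C^{n-1}\times\mathbb C:\operatorname{Re}w_n>|w'|^2\}$, where $|w'|^2=|w_1|^2+\dots+|w_{n-1}|^2$. Set $\psi_0(w)=(\operatorname{Re}w_n-|w'|^2)^{-(n+1)}$; $\log\psi_0$ is called the canonical potential of $\mathbb H^n$. The metric is $\omega_{\mathbb H^n}=\sqrt{-1}\,\partial\bar\partial\log\psi_0=-(n+1)\sqrt{-1}\,\partial\bar\partial\log(\operatorname{Re}w_n-|w'|^2)$, which is the Bergman metric of $\mathbb H^n$ and is Kähler--Einstein with Ricci curvature $-1$. A real function $\eta$ is a Kähler potential of a Kähler form $\omega$ if $\sqrt{-1}\,\partial\bar\partial\eta=\omega$. If $\omega=\sqrt{-1}\sum g_{i\bar j}\,dw_i\wedge d\bar w_j$, and $(g^{k\bar j})$ is the inverse defined by $\sum_j g_{i\bar j}g^{k\bar j}=\delta_{ik}$,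 then $\|\partial\eta\|_\omega^2=\sum_{k,j}g^{k\bar j}\frac{\partial\eta}{\partial w_k}\frac{\partial\eta}{\partial\bar w_j}$. *)

(* Defs.v *)
From HB Require Import structures.
From mathcomp Require Import all_boot all_order all_algebra.
From mathcomp Require Import complex.
From mathcomp Require Import all_classical all_reals all_analysis.

Set Implicit Arguments.
Unset Strict Implicit.
Unset Printing Implicit Defensive.

Import Order.TTheory GRing.Theory Num.Theory.
Import numFieldNormedType.Exports.

Local Open Scope classical_set_scope.
Local Open Scope ring_scope.
Local Open Scope complex_scope.

(* R[i] with the topology of its modulus, as a normed module over itself, so
   that 'rV[R[i]]_n is a complex normed space and [differentiable] between such
   spaces is complex (Frechet) differentiability. *)
HB.instance Definition _ (R : rcfType) := NormedModule.copy R[i] R[i]^o.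

Section ComplexCalculus.
Variables (R : realType) (n : nat).
Local Notation V := 'rV[R[i]]_n.

Definition real_dderive (f : V -> R) (v w : V) : R :=
  derive1 (fun t : R => f (w + t%:C *: v)) 0.

Definition cplx_dderive (F : V -> R[i]) (v w : V) : R[i] :=
  real_dderive (fun z => complex.Re (F z)) v w
  +i* real_dderive (fun z => complex.Im (F z)) v w.

(* Wirtinger operators: d/dw_k = (d/dx_k - i d/dy_k) / 2 and
   d/dwbar_k = (d/dx_k + i d/dy_k) / 2, where w_k = x_k + i y_k. *)
Definition wirtinger (k : 'I_n) (F : V -> R[i]) (w : V) : R[i] :=
  2%:R^-1 * (cplx_dderive F (delta_mx 0 k) w
             - 'i%C * cplx_dderive F ('i%C *: delta_mx 0 k) w).

Definition wirtinger_bar (k : 'I_n) (F : V -> R[i]) (w : V) : R[i] :=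
  2%:R^-1 * (cplx_dderive F (delta_mx 0 k) w
             + 'i%C * cplx_dderive F ('i%C *: delta_mx 0 k) w).

(* (k, false) is the direction of x_k and (k, true) that of y_k. *)
Definition coord_dir (p : 'I_n * bool) : V :=
  (if p.2 then 'i%C else 1) *: delta_mx 0 p.1.

Fixpoint iter_partial (f : V -> R) (s : seq ('I_n * bool)) : V -> R :=
  if s is p :: s' then real_dderive (iter_partial f s') (coord_dir p) else f.

(* C^oo in the real sense on an open set U: the real partial derivatives of
   every order exist and are continuous at every point of U. *)
Definition smooth_on (U : set V) (f : V -> R) : Prop :=
  forall (s : seq ('I_n * bool)) (w : V), U w ->
    continuous_at w (iter_partial f s) /\
    forall p, derivable (fun t : R => iter_partial f s (w + t%:C *: coord_dir p))
                        0 1.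

Definition holomorphic_on (U : set V) (s : V -> V) : Prop :=
  forall w, U w -> differentiable s w.

Definition holomorphic_automorphism (U : set V) (s : V -> V) : Prop :=
  [/\ holomorphic_on U s,
      forall w, U w -> U (s w) &
      exists t : V -> V,
        [/\ holomorphic_on U t,
            forall w, U w -> U (t w),
            forall w, U w -> t (s w) = w &
            forall w, U w -> s (t w) = w]].

(* A (1,1)-form sqrt(-1) sum_ij g_ij dw_i /\ dwbar_j is given by its coefficient
   matrix g; this is the coefficient matrix of sqrt(-1) d dbar eta. *)
Definition ddbar (eta : V -> R) (w : V) : 'M[R[i]]_n :=
  \matrix_(i, j) wirtinger i (wirtinger_bar j (fun z => (eta z)%:C)) w.

Definition kahler_potential (U : set V) (g : V -> 'M[R[i]]_n) (eta : V -> R) :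
    Prop :=
  forall w, U w -> ddbar eta w = g w.

(* The entry (k, j) is g^{k jbar}, where sum_j g_{i jbar} g^{k jbar} = delta_ik:
   this is the transpose of the inverse matrix. *)
Definition inv_metric (g : 'M[R[i]]_n) : 'M[R[i]]_n := (invmx g)^T.

Definition dnorm2 (g : V -> 'M[R[i]]_n) (eta : V -> R) (w : V) : R[i] :=
  \sum_(k < n) \sum_(j < n)
    inv_metric (g w) k j * wirtinger k (fun z => (eta z)%:C) w
                         * wirtinger_bar j (fun z => (eta z)%:C) w.

Definition dnorm (g : V -> 'M[R[i]]_n) (eta : V -> R) (w : V) : R[i] :=
  sqrtC (dnorm2 g eta w).

End ComplexCalculus.

(* The dimension n >= 1 is written m.+1; the last coordinate w_n is
   [w 0 ord_max], and w' consists of the other ones. *)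
Section SiegelHalfSpace.
Variables (R : realType) (m : nat).
Local Notation V := 'rV[R[i]]_m.+1.

Definition siegel_rho (w : V) : R :=
  complex.Re (w 0 ord_max)
  - \sum_(j < m.+1 | j != ord_max)
      (complex.Re (w 0 j) ^+ 2 + complex.Im (w 0 j) ^+ 2).

Definition siegel : set V := [set w | 0 < siegel_rho w].

Definition siegel_base : V := delta_mx 0 ord_max.

(* The exponent is -(n + 1) with n = m.+1. *)
Definition psi0 (w : V) : R := siegel_rho w ^- (m.+1).+1.

Definition siegel_metric (w : V) : 'M[R[i]]_m.+1 :=
  ddbar (fun z => ln (psi0 z)) w.

End SiegelHalfSpace.

Arguments siegel R m : clear implicits.
Arguments siegel_base R m : clear implicits.

(* Main.v *)
From HB Require Import structures.
Require Import Defs.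
From mathcomp Require Import all_boot all_order all_algebra.
From mathcomp Require Import complex.
From mathcomp Require Import all_classical all_reals all_analysis.
From mathcomp Require Import ring lra.
Import Order.TTheory GRing.Theory Num.Theory.
Import numFieldNormedType.Exports.
Local Open Scope classical_set_scope.
Local Open Scope ring_scope.
Local Open Scope complex_scope.
Set Implicit Arguments.
Unset Strict Implicit.
Unset Printing Implicit Defensive.

(* Write rho for Re w_n - |w'|^2. Since log psi - log psi0 is pluriharmonic, its
   derivatives in the w_k are (n + 1) k_k with k_k holomorphic, and the
   inverse of the metric being explicit,
     |d log psi|^2 = (n + 1) (1 + rho E),
     E = sum_(j < n) |k_j|^2 + 4 Re (k_n conj e),  e = sum_j w_j k_j - 1,
   so that rho E is a constant C. Differentiating rho E = C once in w_k at the
   base point gives the derivatives of the k_j in the direction of the gradient;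
   inserting them in the mixed second derivative gives C (C + 1) = 0, and
   C = -1 contradicts positivity of the same second derivative in direction w_n.
   Hence E = 0, which says that the holomorphic vector
   (k_1, .., k_(n-1), k_n + e) has the same length as k_n - e. Their quotient is
   a holomorphic map to the unit sphere, hence constant, and so the k_j are the
   logarithmic derivatives of an affine function l. Thus
   psi = r (rho / |l|^2)^-(n+1), and in the Cayley coordinates l is the
   denominator of the automorphism induced by a unitary matrix whose last column
   is prescribed by the constants. *)

(** * Calculus along real lines *)

(** The solutions are parametrized by boundary points, which is why the statement holds only up to
    isotropy. For a unit vector g the affine function [ell g] vanishes, in the closed ball, exactly
    at the boundary point -conj g. The canonical potential is the case g = (0, .., 0, -1), where
    [ell g] is 1 and the boundary point is the image of infinity. The isotropy group of the base
    point acts on the ball by unitary maps, hence transitively on the sphere. The obstacle is to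
    exclude C != 0. The mixed second derivative of E is quadratic in the unknown matrix of
    derivatives of the k_j. This matrix is symmetric, so the first order equation determines its
    product with the gradient, and contracting with the gradient on both sides removes the unknown.
    Since C + 1 is the squared length of the gradient divided by n + 1, the remaining value C = -1
    is the case of a vanishing gradient. All the identities differentiated here are built from
    products F conj G with F and G holomorphic, so only first derivatives of holomorphic functions
    occur. *)

Section ComplexTopology.
Variable R : realType.

Lemma normc_real (x : R) : `|x%:C| = `|x|%:C.
Proof. by rewrite normc_def /= expr0n addr0 sqrtr_sqr. Qed.

Lemma gt0_realE (e : R[i]) : 0 < e -> e = (complex.Re e)%:C /\ 0 < complex.Re e.
Proof. by rewrite ltcE /= => /andP[/eqP + ->]; case: e => a b /= ->. Qed.

Lemma real_complex_continuous : continuous (fun t : R => t%:C : R[i]).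
Proof.
move=> t; apply/cvgrPdist_lt => e /gt0_realE[-> e0].
near=> s.
rewrite -rmorphB /= normc_real ltcR.
near: s; exact: cvgr_dist_lt.
Unshelve. all: by end_near. Qed.

Lemma Re_continuous : continuous (fun z : R[i] => complex.Re z).
Proof.
move=> t; apply/(@cvgrPdist_lt _ _ _ _ (nbhs_filter t)) => e e0.
near=> s.
rewrite -raddfB /= -ltcR.
apply: le_lt_trans (normc_ge_Re _) _.
near: s; apply/nbhs_normP; exists e%:C => //=; by rewrite ltcR.
Unshelve. all: by end_near. Qed.

Lemma normc_ge_Im (z : R[i]) : `|complex.Im z|%:C <= `|z|.
Proof.
rewrite -normrN -ReiNIm; apply: le_trans (normc_ge_Re _) _.
by rewrite normrM [`|'i%C|]normc_def /= expr0n expr1n add0r sqrtr1 mulr1.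
Qed.

Lemma Im_continuous : continuous (fun z : R[i] => complex.Im z).
Proof.
move=> t; apply/(@cvgrPdist_lt _ _ _ _ (nbhs_filter t)) => e e0.
near=> s.
rewrite -raddfB /= -ltcR.
apply: le_lt_trans (normc_ge_Im _) _.
near: s; apply/nbhs_normP; exists e%:C => //=; by rewrite ltcR.
Unshelve. all: by end_near. Qed.

Lemma line_continuous n (w v : 'rV[R[i]]_n) :
  continuous (fun t : R => w + t%:C *: v).
Proof.
move=> t; apply: cvgD; first exact: cvg_cst.
by apply: cvgZl; exact: real_complex_continuous.
Qed.

End ComplexTopology.

Section RealCalculus.
Variables (R : realType) (n : nat).
Local Notation V := 'rV[R[i]]_n.
Implicit Types (f g : V -> R) (v w : V).

(** A relation that carries existence together with the value, whereas [real_dderive] has a value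
    even where the derivative does not exist. *)
Definition is_dd f v w (df : R) :=
  is_derive (0 : R) (1 : R) (fun t : R => f (w + t%:C *: v)) df.

Lemma is_ddE f v w df : is_dd f v w df -> real_dderive f v w = df.
Proof. by move=> [_ <-]; rewrite /real_dderive derive1E. Qed.

Lemma is_ddP f v w : derivable (fun t : R => f (w + t%:C *: v)) 0 1 ->
  is_dd f v w (real_dderive f v w).
Proof. by move=> df; rewrite /real_dderive derive1E; exact: derivableP. Qed.

Lemma is_dd_eq f v w df dg : is_dd f v w df -> df = dg -> is_dd f v w dg.
Proof. by move=> ? <-. Qed.

Lemma is_dd_cst (c : R) v w : is_dd (fun=> c) v w 0.
Proof. exact: is_derive_cst. Qed.

Lemma is_ddD f g v w df dg : is_dd f v w df -> is_dd g v w dg ->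
  is_dd (fun z => f z + g z) v w (df + dg).
Proof. exact: is_deriveD. Qed.

Lemma is_ddM f g v w df dg : is_dd f v w df -> is_dd g v w dg ->
  is_dd (fun z => f z * g z) v w (df * g w + f w * dg).
Proof.
move=> Hf Hg; apply: is_dd_eq (is_deriveM Hf Hg) _ => /=.
by rewrite !scale0r !addr0 addrC; congr (_ + _); exact: mulrC.
Qed.

Lemma is_dd_comp (h : R -> R) f v w dh df :
  is_derive (f w) (1 : R) h dh -> is_dd f v w df ->
  is_dd (fun z => h (f z)) v w (dh * df).
Proof.
move=> Hh Hf; rewrite /is_dd.
have e0 : w = w + 0%:C *: v by rewrite scale0r addr0.
rewrite [in f w]e0 in Hh.
exact: (is_derive1_comp Hh Hf).
Qed.

Lemma is_ddV f v w df : f w != 0 -> is_dd f v w df ->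
  is_dd (fun z => (f z)^-1) v w (- ((f w)^-1 * (f w)^-1) * df).
Proof.
move=> f0 Hf; have Hf' : is_derive (0 : R) (1 : R) (fun t : R => f (w + t%:C *: v)) df by [].
have e0 : f (w + 0%:C *: v) = f w by rewrite scale0r addr0.
apply: is_derive_eq; first by apply: is_deriveV; rewrite /= e0.
by rewrite /= e0 -exprVn expr2.
Qed.

Lemma is_dd_ln f v w df : 0 < f w -> is_dd f v w df ->
  is_dd (fun z => ln (f z)) v w ((f w)^-1 * df).
Proof. by move=> f0 Hf; apply: (is_dd_comp _ Hf); exact: is_derive1_ln. Qed.

Lemma is_dd_Re j v w : is_dd (fun z => complex.Re (z 0 j)) v w (complex.Re (v 0 j)).
Proof.
rewrite /is_dd.
have -> : (fun t : R => complex.Re ((w + t%:C *: v) 0 j)) =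
   cst (complex.Re (w 0 j)) + (complex.Re (v 0 j) \*: (id : R -> R)).
  apply/funext => t; rewrite !mxE raddfD /=; congr (_ + _); rewrite /GRing.scale /=.
  by case: (v 0 j) => a b /=; rewrite mul0r subr0 mulrC.
apply: is_derive_eq.
by rewrite add0r /GRing.scale /= mulr1.
Qed.

Lemma is_dd_Im j v w : is_dd (fun z => complex.Im (z 0 j)) v w (complex.Im (v 0 j)).
Proof.
rewrite /is_dd.
have -> : (fun t : R => complex.Im ((w + t%:C *: v) 0 j)) =
   cst (complex.Im (w 0 j)) + (complex.Im (v 0 j) \*: (id : R -> R)).
  apply/funext => t; rewrite !mxE raddfD /=; congr (_ + _); rewrite /GRing.scale /=.
  by case: (v 0 j) => a b /=; rewrite mul0r addr0 mulrC.
apply: is_derive_eq.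
by rewrite add0r /GRing.scale /= mulr1.
Qed.

Variable U : set V.
Hypothesis oU : open U.

Lemma near_line v w : U w -> \forall t \near (0 : R), U (w + t%:C *: v).
Proof.
move=> Uw; have := @line_continuous R n w v 0; apply.
by rewrite scale0r addr0; exact: open_nbhs_nbhs.
Qed.

Lemma is_dd_eq_on f g v w df : (forall z, U z -> f z = g z) -> U w ->
  is_dd f v w df -> is_dd g v w df.
Proof.
move=> fg Uw; apply: near_eq_is_derive.
by apply: filterS (near_line v Uw) => t /fg.
Qed.

Lemma real_dderive_eq_on f g v w : (forall z, U z -> f z = g z) -> U w ->
  real_dderive f v w = real_dderive g v w.
Proof.
move=> fg Uw; rewrite /real_dderive !derive1E; apply: near_eq_derive.
by apply: filterS (near_line v Uw) => t /fg.
Qed.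

Lemma continuous_eq_on f g w : (forall z, U z -> f z = g z) -> U w ->
  continuous_at w f -> continuous_at w g.
Proof.
move=> fg Uw; rewrite /continuous_at -(fg _ Uw); apply: cvg_trans.
apply: (@near_eq_cvg _ _ (nbhs w) (nbhs_filter w) f g).
apply: (@filterS _ (nbhs w) (nbhs_filter w)) (open_nbhs_nbhs (conj oU Uw)).
exact: fg.
Qed.

(** By induction on [s], [iter_partial f s] agrees on [U] with a member of [S]. Smoothness of a
    formula thus reduces to closing a class of formulas under a single derivative. *)
Lemma smooth_coind (S : (V -> R) -> Prop) :
  (forall f, S f -> (forall w, U w -> continuous_at w f) /\
     forall p, exists2 g, S g & forall w, U w -> is_dd f (coord_dir R p) w (g w)) ->
  forall f, S f -> smooth_on U f.
Proof.
move=> HS f Sf s.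
have [g Sg fg] : exists2 g, S g & forall w, U w -> g w = iter_partial f s w.
  elim: s => [|p s [g Sg IH]]; first by exists f.
  have [_ /(_ p)[h Sh gh]] := HS _ Sg; exists h => // w Uw /=.
  by rewrite -(real_dderive_eq_on _ IH Uw) (is_ddE (gh _ Uw)).
move=> w Uw; have [cg dg] := HS _ Sg; split.
  by apply: continuous_eq_on fg Uw (cg _ Uw).
move=> p; have [h _ gh] := dg p.
by have [] := is_dd_eq_on fg Uw (gh _ Uw).
Qed.

Lemma smooth_continuous f w : smooth_on U f -> U w -> continuous_at w f.
Proof. by move=> /(_ [::] w) + Uw => /(_ Uw)[]. Qed.

Lemma smooth_is_dd f p w : smooth_on U f -> U w ->
  is_dd f (coord_dir R p) w (real_dderive f (coord_dir R p) w).
Proof. by move=> /(_ [::] w) + Uw => /(_ Uw)[_ /(_ p)]; exact: is_ddP. Qed.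

Lemma smooth_dderive f p : smooth_on U f ->
  smooth_on U (real_dderive f (coord_dir R p)).
Proof.
(* The head of the list is the outermost derivative, so the innermost one is appended at the end. *)
move=> Sf s; have := Sf (rcons s p).
suff -> : iter_partial f (rcons s p) =
  iter_partial (real_dderive f (coord_dir R p)) s by [].
by elim: s => //= q s ->.
Qed.

(** The class given to [smooth_coind]. [SgSmooth] admits arbitrary smooth functions, so each
    constructor yields a closure property of smoothness; opposites are written as products with the
    constant -1. *)
Inductive smooth_gen : (V -> R) -> Prop :=
| SgSmooth f of smooth_on U f : smooth_gen f
| SgCst c : smooth_gen (fun=> c)
| SgRe j : smooth_gen (fun z => complex.Re (z 0 j))
| SgIm j : smooth_gen (fun z => complex.Im (z 0 j))
| SgD f g of smooth_gen f & smooth_gen g : smooth_gen (fun z => f z + g z)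
| SgM f g of smooth_gen f & smooth_gen g : smooth_gen (fun z => f z * g z)
| SgV f of smooth_gen f & (forall w, U w -> f w != 0) :
    smooth_gen (fun z => (f z)^-1)
| SgLn f of smooth_gen f & (forall w, U w -> 0 < f w) :
    smooth_gen (fun z => ln (f z)).

Lemma smooth_gen_smooth f : smooth_gen f -> smooth_on U f.
Proof.
move: f; apply: smooth_coind => f; elim => {f}.
- move=> f Sf; split=> [w|p]; first exact: smooth_continuous.
  exists (real_dderive f (coord_dir R p)); last by move=> w; exact: smooth_is_dd.
  exact/SgSmooth/smooth_dderive.
- move=> c; split=> [w _|p]; first exact: cst_continuous.
  by exists (fun=> 0) => [|w _]; [exact: SgCst | exact: is_dd_cst].
- move=> j; split=> [w _|p].
    by apply: (@continuous_comp _ _ _ (fun z : V => z 0 j) (@complex.Re R));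
      [exact: coord_continuous | exact: Re_continuous].
  by exists (fun=> complex.Re (coord_dir R p 0 j)) => [|w _]; [exact: SgCst | exact: is_dd_Re].
- move=> j; split=> [w _|p].
    by apply: (@continuous_comp _ _ _ (fun z : V => z 0 j) (@complex.Im R));
      [exact: coord_continuous | exact: Im_continuous].
  by exists (fun=> complex.Im (coord_dir R p 0 j)) => [|w _]; [exact: SgCst | exact: is_dd_Im].
- move=> f g Sf [cf df] Sg [cg dg]; split=> [w Uw|p]; first rewrite /continuous_at.
    exact: (cvgD (cf _ Uw) (cg _ Uw)).
  have [f' Sf' Hf] := df p; have [g' Sg' Hg] := dg p.
  exists (fun z => f' z + g' z); first exact: SgD.
  by move=> w Uw; apply: is_ddD; [exact: Hf | exact: Hg].
- move=> f g Sf [cf df] Sg [cg dg]; split=> [w Uw|p]; first rewrite /continuous_at.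
    exact: (cvgM (cf _ Uw) (cg _ Uw)).
  have [f' Sf' Hf] := df p; have [g' Sg' Hg] := dg p.
  exists (fun z => f' z * g z + f z * g' z); first by apply: SgD; exact: SgM.
  by move=> w Uw; apply: is_ddM; [exact: Hf | exact: Hg].
- move=> f Sf [cf df] f0; split=> [w Uw|p]; first rewrite /continuous_at.
    exact: (cvgV (f0 _ Uw) (cf _ Uw)).
  have [f' Sf' Hf] := df p.
  exists (fun z => -1 * ((f z)^-1 * (f z)^-1) * f' z).
    apply: SgM => //; apply: SgM; first exact: SgCst.
    by apply: SgM; exact: SgV.
  by move=> w Uw; rewrite mulN1r; apply: is_ddV; [exact: f0 | exact: Hf].
- move=> f Sf [cf df] f0; split=> [w Uw|p]; first rewrite /continuous_at.
    apply: (@continuous_comp _ _ _ f (@ln R)); first exact: cf.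
    exact/continuous_ln/f0.
  have [f' Sf' Hf] := df p.
  exists (fun z => (f z)^-1 * f' z).
    by apply: SgM => //; apply: SgV => // w /f0; rewrite lt0r => /andP[].
  by move=> w Uw; apply: is_dd_ln; [exact: f0 | exact: Hf].
Qed.

End RealCalculus.

(** * Symmetry of mixed derivatives *)

(* Applying the mean value theorem in each variable writes the second
   difference, which is symmetric in the two variables, as [h^2] times a mixed
   derivative at a nearby point. *)
Lemma second_difference (R : realType) (F F1 F12 : R -> R -> R) (h : R) : 0 < h ->
  (forall s t, 0 <= s <= h -> 0 <= t <= h ->
     is_derive s (1 : R) (F^~ t) (F1 s t)) ->
  (forall s t, 0 <= s <= h -> 0 <= t <= h ->
     is_derive t (1 : R) (F1 s) (F12 s t)) ->
  exists s t, [/\ 0 <= s <= h, 0 <= t <= h &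
    F h h - F h 0 - (F 0 h - F 0 0) = h * h * F12 s t].
Proof.
move=> h0 D1 D2.
have hh : 0 <= h <= h by rewrite lexx ltW.
have h00 : 0 <= (0 : R) <= h by rewrite lexx ltW.
have Dg s : 0 <= s <= h ->
    is_derive s (1 : R) (F^~ h - F^~ 0) (F1 s h - F1 s 0).
  by move=> hs; apply: is_deriveB; apply: D1.
have sub x : x \in `]0, h[ -> 0 <= x <= h.
  by rewrite in_itv /= => /andP[x0 xh]; rewrite !ltW.
have sub' x : x \in `[0, h] -> 0 <= x <= h by rewrite in_itv.
have [|s /sub hs Es] := @MVT R _ _ 0 h h0 (fun x hx => Dg x (sub x hx)).
  apply: derivable_within_continuous => x /sub' hx.
  by have [] := Dg x hx.
have [|t /sub ht Et] := @MVT R _ _ 0 h h0 (fun x hx => D2 s x hs (sub x hx)).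
  apply: derivable_within_continuous => x /sub' hx.
  by have [] := D2 s x hs hx.
exists s, t; split=> //.
have -> : F h h - F h 0 - (F 0 h - F 0 0) =
    (F^~ h - F^~ 0) h - (F^~ h - F^~ 0) 0 by [].
by rewrite Es Et !subr0; ring.
Qed.

Section Schwarz.
Variables (R : realType) (n : nat) (U : set 'rV[R[i]]_n).
Hypothesis oU : open U.
Local Notation V := 'rV[R[i]]_n.
Local Notation dir := (coord_dir R).
Implicit Types (f g : V -> R) (v w : V).

Lemma is_dd_line f v w s df : is_dd f v (w + s%:C *: v) df ->
  is_derive s (1 : R) (fun t : R => f (w + t%:C *: v)) df.
Proof.
move=> H.
have -> : (fun t : R => f (w + t%:C *: v)) =
    (fun t : R => f (w + s%:C *: v + t%:C *: v)) \o (fun t => t - s).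
  apply/funext => t /=; congr f; rewrite -addrA -scalerDl -rmorphD /=.
  by congr (_ + _%:C *: _); ring.
rewrite -[df]mulr1; apply: is_derive1_comp; first by rewrite subrr.
by apply: is_derive_eq; rewrite ?subr0.
Qed.

Lemma is_dd_line2 f v w y s df : is_dd f v (w + s%:C *: v + y) df ->
  is_derive s (1 : R) (fun t : R => f (w + t%:C *: v + y)) df.
Proof.
have sw t : w + t%:C *: v + y = (w + y) + t%:C *: v by exact: addrAC.
have -> : (fun t : R => f (w + t%:C *: v + y)) =
    (fun t : R => f ((w + y) + t%:C *: v)).
  by apply/funext => t; congr f; exact: sw.
by rewrite sw; exact: is_dd_line.
Qed.

Lemma near_plane (P : set V) w v v' : nbhs w P ->
  exists2 r : R, 0 < r &
    forall s t : R, `|s| < r -> `|t| < r -> P (w + s%:C *: v + t%:C *: v').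
Proof.
move=> Pw.
have Hc : (fun x : R * R => w + x.1%:C *: v + x.2%:C *: v') x @[x --> (0, 0)]
    --> w + (0 : R)%:C *: v + (0 : R)%:C *: v'.
  apply: cvgD; first apply: cvgD.
  - exact: cvg_cst.
  - apply: cvgZl; apply: (@cvg_comp _ _ _ (@fst R R) (fun t : R => t%:C)).
      exact: cvg_fst.
    exact: real_complex_continuous.
  - apply: cvgZl; apply: (@cvg_comp _ _ _ (@snd R R) (fun t : R => t%:C)).
      exact: cvg_snd.
    exact: real_complex_continuous.
rewrite !scale0r !addr0 in Hc.
have /nbhs_ballP[r /= r0 Hr] := Hc _ Pw.
exists r => // s t Hs Ht; apply: (Hr (s, t)).
by split; rewrite /= /ball /= sub0r normrN.
Qed.

(** Expanding one second difference in both orders shows that [A] and [B] take a common value at two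
    points of an arbitrarily small parallelogram at [w]; continuity at [w] then transfers the
    equality to [w]. *)
Lemma mixed_derivatives_eq f fp fq A B v v' w :
  (forall z, U z -> is_dd f v z (fp z)) ->
  (forall z, U z -> is_dd fp v' z (A z)) ->
  (forall z, U z -> is_dd f v' z (fq z)) ->
  (forall z, U z -> is_dd fq v z (B z)) ->
  U w -> continuous_at w A -> continuous_at w B -> A w = B w.
Proof.
move=> Hp Hpq Hq Hqp Uw cA cB.
apply/eqP; rewrite -subr_eq0 -normr_le0; apply/ler_addgt0Pl => e e0.
rewrite addr0.
have e20 : 0 < e / 2 by rewrite divr_gt0.
have nA : nbhs w [set z | `|A w - A z| < e / 2].
  by have /(@cvgrPdist_lt _ _ _ _ (nbhs_filter w)) := cA; apply.
have nB : nbhs w [set z | `|B w - B z| < e / 2].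
  by have /(@cvgrPdist_lt _ _ _ _ (nbhs_filter w)) := cB; apply.
have nU : nbhs w U by exact: open_nbhs_nbhs.
have [r r0 Hr] := near_plane v v' (filterI nU (filterI nA nB)).
(* Halving puts the closed range from 0 to [h] inside the strict bound by [r]. *)
pose h := r / 2.
have h0 : 0 < h by rewrite divr_gt0.
have small x : 0 <= x <= h -> `|x| < r.
  move=> /andP[x0 xh]; rewrite ger0_norm//; apply: le_lt_trans xh _.
  by rewrite /h; lra.
pose X s t := w + s%:C *: v + t%:C *: v'.
have XU s t : 0 <= s <= h -> 0 <= t <= h -> U (X s t).
  by move=> hs ht; have [] := Hr s t (small _ hs) (small _ ht).
have XA s t : 0 <= s <= h -> 0 <= t <= h -> `|A w - A (X s t)| < e / 2.
  by move=> hs ht; have [_ []] := Hr s t (small _ hs) (small _ ht).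
have XB s t : 0 <= s <= h -> 0 <= t <= h -> `|B w - B (X s t)| < e / 2.
  by move=> hs ht; have [_ []] := Hr s t (small _ hs) (small _ ht).
have Ap s t (hs : 0 <= s <= h) (ht : 0 <= t <= h) : is_derive s (1 : R)
    (fun s => f (X s t)) (fp (X s t)).
  by apply: is_dd_line2; exact: (Hp _ (XU _ _ hs ht)).
have Apq s t (hs : 0 <= s <= h) (ht : 0 <= t <= h) : is_derive t (1 : R)
    (fun t => fp (X s t)) (A (X s t)).
  by apply: is_dd_line; exact: (Hpq _ (XU _ _ hs ht)).
have Bq s t (hs : 0 <= s <= h) (ht : 0 <= t <= h) : is_derive t (1 : R)
    (fun t => f (X s t)) (fq (X s t)).
  by apply: is_dd_line; exact: (Hq _ (XU _ _ hs ht)).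
have Bqp s t (hs : 0 <= s <= h) (ht : 0 <= t <= h) : is_derive s (1 : R)
    (fun s => fq (X s t)) (B (X s t)).
  by apply: is_dd_line2; exact: (Hqp _ (XU _ _ hs ht)).
have [s [t [hs ht E1]]] := @second_difference R _ _ _ h h0 Ap Apq.
(* The same function with its two variables exchanged. *)
have [t' [s' [ht' hs' E2]]] := @second_difference R (fun t s => f (X s t))
  (fun t s => fq (X s t)) (fun t s => B (X s t)) h h0
  (fun t s ht hs => Bq s t hs ht) (fun t s ht hs => Bqp s t hs ht).
have symm (a b c d x y : R) :
    a - b - (c - d) = h * h * x -> a - c - (b - d) = h * h * y -> x = y.
  move=> Hx Hy; apply: (@mulfI _ (h * h)); first by rewrite mulf_neq0 // gt_eqF.
  by rewrite -Hx -Hy; ring.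
have EAB : A (X s t) = B (X s' t') by exact: symm E1 E2.
have HA := XA s t hs ht; have HB := XB s' t' hs' ht'.
rewrite EAB in HA.
rewrite (_ : A w - B w = (A w - B (X s' t')) -
   (B w - B (X s' t'))); last by ring.
apply: le_trans (ler_normB _ _) _.
by rewrite ltW // [ltRHS]splitr ltrD.
Qed.

Lemma real_dderiveC f p q w : smooth_on U f -> U w ->
  real_dderive (real_dderive f (dir p)) (dir q) w =
  real_dderive (real_dderive f (dir q)) (dir p) w.
Proof.
move=> Sf Uw.
have Sp := smooth_dderive p Sf; have Sq := smooth_dderive q Sf.
exact: (mixed_derivatives_eq (fun z => smooth_is_dd p Sf)
  (fun z => smooth_is_dd q Sp) (fun z => smooth_is_dd q Sf)
  (fun z => smooth_is_dd p Sq) Uw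
  (smooth_continuous (smooth_dderive q Sp) Uw)
  (smooth_continuous (smooth_dderive p Sq) Uw)).
Qed.

End Schwarz.

(** * Wirtinger derivatives *)

(* Complex conjugation, at one fixed algebraic structure on [R[i]]. *)
Definition cj (R : realType) (z : R[i]) : R[i] := complex.Re z -i* complex.Im z.

Section Conjugation.
Variable R : realType.
Implicit Types z w : R[i].

Lemma cjE z : cj z = conjc z. Proof. by case: z. Qed.
Lemma cjK z : cj (cj z) = z. Proof. by case: z => a b; rewrite /cj /= opprK. Qed.
Lemma cjD z w : cj (z + w) = cj z + cj w. Proof. by rewrite !cjE rmorphD. Qed.
Lemma cjM z w : cj (z * w) = cj z * cj w. Proof. by rewrite !cjE rmorphM. Qed.
Lemma cjN z : cj (- z) = - cj z. Proof. by rewrite !cjE rmorphN. Qed.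
Lemma cjV z : cj z^-1 = (cj z)^-1. Proof. by rewrite !cjE conjc_inv. Qed.
Lemma cj_nat k : cj k%:R = k%:R :> R[i]. Proof. by rewrite cjE conjc_nat. Qed.
Lemma cj0 : cj 0 = 0 :> R[i]. Proof. exact: (cj_nat 0). Qed.
Lemma cj1 : cj 1 = 1 :> R[i]. Proof. exact: (cj_nat 1). Qed.
Lemma cj_real (x : R) : cj x%:C = x%:C. Proof. by rewrite /cj /= oppr0. Qed.
Lemma cj_eq0 z : (cj z == 0) = (z == 0). Proof. by rewrite cjE conjc_eq0. Qed.
Lemma mul_cj z : z * cj z = `|z| ^+ 2. Proof. by rewrite cjE sqr_normc. Qed.
Lemma cj_sum (I : finType) (P : pred I) (F : I -> R[i]) :
  cj (\sum_(i | P i) F i) = \sum_(i | P i) cj (F i).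
Proof. by rewrite cjE rmorph_sum; apply: eq_bigr => i _; rewrite cjE. Qed.

End Conjugation.

(* The locks keep the unifier from comparing distinct coordinate directions by
   unfolding them. *)
HB.lock Definition cpartial (R : realType) n (p : 'I_n * bool)
    (F : 'rV[R[i]]_n -> R[i]) (w : 'rV[R[i]]_n) : R[i] :=
  cplx_dderive F (coord_dir R p) w.

Section ComplexDerivatives.
Variables (R : realType) (n : nat).
Local Notation V := 'rV[R[i]]_n.
Local Notation dir := (coord_dir R).
Implicit Types (F G : V -> R[i]) (f g : V -> R) (w : V).

Definition is_cd F v w (d : R[i]) :=
  is_dd (fun z => complex.Re (F z)) v w (complex.Re d) /\
  is_dd (fun z => complex.Im (F z)) v w (complex.Im d).

Lemma is_cdE p F w d : is_cd F (dir p) w d -> cpartial p F w = d.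
Proof.
move=> [/is_ddE HR /is_ddE HI]; rewrite cpartial.unlock /cplx_dderive HR HI.
by case: d {HR HI}.
Qed.

Lemma ReD (x y : R[i]) : complex.Re (x + y) = complex.Re x + complex.Re y.
Proof. by case: x; case: y. Qed.

Lemma ImD (x y : R[i]) : complex.Im (x + y) = complex.Im x + complex.Im y.
Proof. by case: x; case: y. Qed.

Lemma is_cdD F G v w dF dG : is_cd F v w dF -> is_cd G v w dG ->
  is_cd (fun z => F z + G z) v w (dF + dG).
Proof.
move=> [HF1 HF2] [HG1 HG2]; split; [rewrite ReD | rewrite ImD].
- by under eq_fun do rewrite ReD; exact: is_ddD.
- by under eq_fun do rewrite ImD; exact: is_ddD.
Qed.

Lemma ReM (x y : R[i]) :
  complex.Re (x * y) = complex.Re x * complex.Re y - complex.Im x * complex.Im y.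
Proof. by case: x; case: y. Qed.

Lemma ImM (x y : R[i]) :
  complex.Im (x * y) = complex.Re x * complex.Im y + complex.Im x * complex.Re y.
Proof. by case: x; case: y. Qed.

Lemma is_ddN f v w df : is_dd f v w df -> is_dd (fun z => - f z) v w (- df).
Proof. exact: is_deriveN. Qed.

Lemma is_cdM F G v w dF dG : is_cd F v w dF -> is_cd G v w dG ->
  is_cd (fun z => F z * G z) v w (dF * G w + F w * dG).
Proof.
move=> [HF1 HF2] [HG1 HG2]; split.
- under eq_fun do rewrite ReM.
  apply: is_dd_eq (is_ddD (is_ddM HF1 HG1) (is_ddN (is_ddM HF2 HG2))) _.
  by rewrite ReD !ReM; ring.
- under eq_fun do rewrite ImM.
  apply: is_dd_eq (is_ddD (is_ddM HF1 HG2) (is_ddM HF2 HG1)) _.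
  by rewrite ImD !ImM; ring.
Qed.

Lemma is_cd_cst c v w : is_cd (fun=> c) v w 0.
Proof. by split; exact: is_dd_cst. Qed.

Lemma is_cd_conj F v w dF : is_cd F v w dF -> is_cd (fun z => cj (F z)) v w (cj dF).
Proof.
have Rc (x : R[i]) : complex.Re (cj x) = complex.Re x by case: x.
have Ic (x : R[i]) : complex.Im (cj x) = - complex.Im x by case: x.
move=> [HF1 HF2]; split; [rewrite Rc | rewrite Ic].
- by under eq_fun do rewrite Rc.
- by under eq_fun do rewrite Ic; exact: is_ddN.
Qed.

Lemma is_cd_coord j v w : is_cd (fun z => z 0 j) v w (v 0 j).
Proof. by split; [exact: is_dd_Re | exact: is_dd_Im]. Qed.

Lemma is_cd_real f v w df : is_dd f v w df -> is_cd (fun z => (f z)%:C) v w df%:C.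
Proof. by move=> Hf; split=> //; exact: is_dd_cst. Qed.

Variable U : set V.
Hypothesis oU : open U.

Lemma is_cd_eq_on F G v w d : (forall z, U z -> F z = G z) -> U w ->
  is_cd F v w d -> is_cd G v w d.
Proof.
move=> FG Uw [H1 H2].
by split; [apply: (is_dd_eq_on oU _ Uw H1) | apply: (is_dd_eq_on oU _ Uw H2)];
  move=> z Uz; rewrite FG.
Qed.

Definition csmooth F := smooth_on U (fun z => complex.Re (F z)) /\
  smooth_on U (fun z => complex.Im (F z)).

Lemma csmooth_is_cd p F w : csmooth F -> U w -> is_cd F (dir p) w (cpartial p F w).
Proof.
move=> [S1 S2] Uw; rewrite cpartial.unlock; split.
- exact: (smooth_is_dd p S1 Uw).
- exact: (smooth_is_dd p S2 Uw).
Qed.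

Lemma csmooth_cpartial p F : csmooth F -> csmooth (cpartial p F).
Proof. by move=> [S1 S2]; rewrite cpartial.unlock; split; exact: smooth_dderive. Qed.

Lemma cpartialC p q F w : csmooth F -> U w ->
  cpartial p (cpartial q F) w = cpartial q (cpartial p F) w.
Proof.
move=> [S1 S2] Uw; rewrite cpartial.unlock.
exact: (f_equal2 (@Complex R) (real_dderiveC oU q p S1 Uw) (real_dderiveC oU q p S2 Uw)).
Qed.

Lemma smoothW f : smooth_on U f -> smooth_gen U f. Proof. exact: SgSmooth. Qed.

Lemma csmooth_cst c : csmooth (fun=> c).
Proof. by split; apply: smooth_gen_smooth => //; exact: SgCst. Qed.

Lemma csmooth_real f : smooth_on U f -> csmooth (fun z => (f z)%:C).
Proof. move=> Sf; split; first exact: Sf.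
by apply: (smooth_gen_smooth oU); exact: (SgCst U 0). Qed.

Lemma csmooth_coord j : csmooth (fun z => z 0 j).
Proof. by split; apply: smooth_gen_smooth => //; [exact: SgRe | exact: SgIm]. Qed.

Lemma csmoothD F G : csmooth F -> csmooth G -> csmooth (fun z => F z + G z).
Proof.
move=> [/smoothW F1 /smoothW F2] [/smoothW G1 /smoothW G2].
split; [under eq_fun do rewrite ReD | under eq_fun do rewrite ImD];
  by apply: smooth_gen_smooth => //; exact: SgD.
Qed.

Lemma csmoothM F G : csmooth F -> csmooth G -> csmooth (fun z => F z * G z).
Proof.
move=> [/smoothW F1 /smoothW F2] [/smoothW G1 /smoothW G2]; split.
- under eq_fun do rewrite ReM -mulN1r.
  apply: smooth_gen_smooth => //; apply: SgD; first exact: SgM.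
  by apply: SgM; [exact: SgCst | exact: SgM].
- under eq_fun do rewrite ImM.
  by apply: smooth_gen_smooth => //; apply: SgD; exact: SgM.
Qed.

Lemma csmoothZ c F : csmooth F -> csmooth (fun z => c * F z).
Proof. by apply: csmoothM; exact: csmooth_cst. Qed.

Lemma csmooth_sum (I : finType) (P : pred I) (F : I -> V -> R[i]) :
  (forall i, csmooth (F i)) -> csmooth (fun z => \sum_(i | P i) F i z).
Proof.
move=> SF; elim: (index_enum I) => [|i s IH].
  by under eq_fun do rewrite big_nil; exact: csmooth_cst.
under eq_fun do rewrite big_cons.
by case: (P i); [exact: (csmoothD (SF i) IH) | exact: IH].
Qed.

Lemma csmooth_conj F : csmooth F -> csmooth (fun z => cj (F z)).
Proof.
have Rc (x : R[i]) : complex.Re (cj x) = complex.Re x by case: x.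
have Ic (x : R[i]) : complex.Im (cj x) = -1 * complex.Im x by rewrite mulN1r.
move=> [S1 /smoothW S2]; split; first by under eq_fun do rewrite Rc.
under eq_fun do rewrite Ic; apply: smooth_gen_smooth => //.
by apply: SgM => //; exact: SgCst.
Qed.

Lemma csmoothV F : csmooth F -> (forall w, U w -> F w != 0) ->
  csmooth (fun z => (F z)^-1).
Proof.
move=> [/smoothW S1 /smoothW S2] F0.
pose N := fun z => complex.Re (F z) * complex.Re (F z) +
  complex.Im (F z) * complex.Im (F z).
have SN : smooth_gen U N by apply: SgD; exact: SgM.
have N0 w : U w -> N w != 0.
  move=> /F0; apply: contra; rewrite /N -!expr2 paddr_eq0 ?sqr_ge0//.
  by rewrite !sqrf_eq0 => /andP[/eqP a0 /eqP b0]; rewrite eq_complex a0 b0 /= !eqxx.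
have -> : (fun z => (F z)^-1) =
    (fun z => (complex.Re (F z) * (N z)^-1) +i* (-1 * (complex.Im (F z) * (N z)^-1))).
  by apply/funext => z; rewrite /N -!expr2; case: (F z) => a b /=; rewrite mulN1r.
split=> /=; apply: smooth_gen_smooth => //.
- by apply: SgM => //; exact: SgV.
- by apply: SgM; [exact: SgCst | apply: SgM => //; exact: SgV].
Qed.

Lemma smooth_ln f : smooth_on U f -> (forall w, U w -> 0 < f w) ->
  smooth_on U (fun z => ln (f z)).
Proof. by move=> /smoothW Sf f0; apply: smooth_gen_smooth => //; exact: SgLn. Qed.

End ComplexDerivatives.

(* [dz false k] is the Wirtinger derivative in [w_k] and [dz true k] the one in
   its conjugate. *)
HB.lock Definition dz (R : realType) n (b : bool) (k : 'I_n)
    (F : 'rV[R[i]]_n -> R[i]) (w : 'rV[R[i]]_n) : R[i] :=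
  (if b then wirtinger_bar else wirtinger) _ _ k F w.

Section Wirtinger.
Variables (R : realType) (n : nat) (U : set 'rV[R[i]]_n).
Hypothesis oU : open U.
Local Notation V := 'rV[R[i]]_n.
Implicit Types (F G : V -> R[i]) (f g : V -> R) (w : V).
Local Notation csmooth := (csmooth U).

Let sg (b : bool) : R[i] := if b then 'i%C else - 'i%C.

Lemma dzE b k F w : dz b k F w =
  2%:R^-1 * (cpartial (k, false) F w + sg b * cpartial (k, true) F w).
Proof.
rewrite dz.unlock cpartial.unlock /coord_dir /= scale1r.
by case: b; rewrite /sg ?mulNr.
Qed.

Lemma dz_eq_on b k F G w : csmooth F -> (forall z, U z -> F z = G z) -> U w ->
  dz b k F w = dz b k G w.
Proof.
move=> SF FG Uw; rewrite !dzE.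
by rewrite -!(is_cdE (is_cd_eq_on oU FG Uw (csmooth_is_cd _ SF Uw))).
Qed.

Lemma csmooth_dz b k F : csmooth F -> csmooth (dz b k F).
Proof.
move=> SF.
have -> : dz b k F = fun w =>
    2%:R^-1 * (cpartial (k, false) F w + sg b * cpartial (k, true) F w).
  by apply/funext => w; exact: dzE.
apply: (csmoothZ oU); apply: (csmoothD oU); last apply: (csmoothZ oU);
  exact: csmooth_cpartial.
Qed.

Lemma dz_cst b k c w : dz b k (fun=> c) w = 0.
Proof. by rewrite dzE !(is_cdE (is_cd_cst _ _ _)) mulr0 addr0 mulr0. Qed.

Lemma dzD b k F G w : csmooth F -> csmooth G -> U w ->
  dz b k (fun z => F z + G z) w = dz b k F w + dz b k G w.
Proof.
move=> SF SG Uw; rewrite !dzE.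
rewrite !(fun p => is_cdE (is_cdD (csmooth_is_cd p SF Uw) (csmooth_is_cd p SG Uw))).
by ring.
Qed.

Lemma dzM b k F G w : csmooth F -> csmooth G -> U w ->
  dz b k (fun z => F z * G z) w = dz b k F w * G w + F w * dz b k G w.
Proof.
move=> SF SG Uw; rewrite !dzE.
rewrite !(fun p => is_cdE (is_cdM (csmooth_is_cd p SF Uw) (csmooth_is_cd p SG Uw))).
by ring.
Qed.

Lemma dzZ b k c F w : csmooth F -> U w ->
  dz b k (fun z => c * F z) w = c * dz b k F w.
Proof.
move=> SF Uw; have Sc := csmooth_cst oU c.
by rewrite (dzM b k Sc SF Uw) dz_cst mul0r add0r.
Qed.

Lemma dz_sum b k (I : finType) (P : pred I) (F : I -> V -> R[i]) w :
  (forall i, csmooth (F i)) -> U w ->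
  dz b k (fun z => \sum_(i | P i) F i z) w = \sum_(i | P i) dz b k (F i) w.
Proof.
move=> SF Uw.
(* Smoothness of the partial sums is carried through the induction, because [dzD] requires it at
   every step. *)
suff : csmooth (fun z => \sum_(i | P i) F i z) /\
  dz b k (fun z => \sum_(i | P i) F i z) w = \sum_(i | P i) dz b k (F i) w by case.
elim: (index_enum I) => [|i s [S IH]].
  under eq_fun do rewrite big_nil.
  by rewrite big_nil dz_cst; split=> //; exact: (csmooth_cst oU).
under eq_fun do rewrite big_cons.
rewrite big_cons; case: (P i); last by split; [exact: S | exact: IH].
by split; [exact: (csmoothD oU (SF i) S) | rewrite (dzD _ _ (SF i) S Uw) IH].
Qed.

Lemma dz_conj b k F w : csmooth F -> U w ->
  dz b k (fun z => cj (F z)) w = cj (dz (~~ b) k F w).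
Proof.
move=> SF Uw; rewrite !dzE.
rewrite !(fun p => is_cdE (is_cd_conj (csmooth_is_cd p SF Uw))).
rewrite cjM cjD cjM cjV cj_nat.
suff -> : cj (sg (~~ b)) = sg b by [].
by rewrite /sg; case: b => /=; apply/eqP; rewrite eq_complex /= ?oppr0 ?opprK !eqxx.
Qed.

Lemma dz_coord b k j w : dz b k (fun z => z 0 j) w = ((~~ b) && (k == j))%:R.
Proof.
rewrite dzE !(is_cdE (is_cd_coord _ _ _)) /coord_dir /= !mxE eqxx /=.
rewrite eq_sym mul1r mulrA.
have -> : sg b * 'i%C = (if b then -1 else 1).
  by case: b; rewrite /sg ?mulNr -expr2 sqr_i ?opprK.
by case: b => /=; case: (k == j);
  rewrite ?mulr0 ?addr0 ?mulr0 // ?mulr1 ?addrN ?mulr0 // -mulr2n mulVf // pnatr_eq0.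
Qed.

Lemma dzV b k F w : csmooth F -> (forall z, U z -> F z != 0) -> U w ->
  dz b k (fun z => (F z)^-1) w = - (dz b k F w) / (F w ^+ 2).
Proof.
move=> SF F0 Uw.
have SV := csmoothV oU SF F0.
have E1 z : U z -> F z * (F z)^-1 = 1 by move=> /F0 Fz; rewrite divff.
have E2 := dz_eq_on b k (csmoothM oU SF SV) E1 Uw.
have := etrans (esym E2) (dzM b k SF SV Uw).
rewrite dz_cst => H; apply: (mulfI (F0 _ Uw)).
move/esym/eqP: H; rewrite addrC addr_eq0 => /eqP ->.
by field; exact: F0.
Qed.

Lemma dz_ln b k f w : smooth_on U f -> (forall z, U z -> 0 < f z) -> U w ->
  dz b k (fun z => (ln (f z))%:C) w = dz b k (fun z => (f z)%:C) w / (f w)%:C.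
Proof.
move=> Sf f0 Uw; rewrite !dzE.
have f0' : (f w)%:C != 0 by rewrite fmorph_eq0 gt_eqF ?f0.
have D p : cpartial p (fun z => (ln (f z))%:C) w =
    cpartial p (fun z => (f z)%:C) w / (f w)%:C.
  apply: etrans (is_cdE (is_cd_real (is_dd_ln (f0 _ Uw) (smooth_is_dd p Sf Uw)))) _.
  by rewrite (is_cdE (is_cd_real (smooth_is_dd p Sf Uw))) mulrC rmorphM /= fmorphV.
have aux (a b' c s x y : R[i]) : a = x / c -> b' = y / c ->
    2%:R^-1 * (a + s * b') = 2%:R^-1 * (x + s * y) / c.
  by move=> -> ->; ring.
exact: aux (D _) (D _).
Qed.

Lemma dzC b k b' l F w : csmooth F -> U w ->
  dz b k (dz b' l F) w = dz b' l (dz b k F) w.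
Proof.
move=> SF Uw.
have D p b0 k0 : cpartial p (dz b0 k0 F) w =
    2%:R^-1 * (cpartial p (cpartial (k0, false) F) w +
               sg b0 * cpartial p (cpartial (k0, true) F) w).
  have -> : dz b0 k0 F = fun w =>
    2%:R^-1 * (cpartial (k0, false) F w + sg b0 * cpartial (k0, true) F w).
    by apply/funext => z; exact: dzE.
  have H q := csmooth_is_cd p (csmooth_cpartial q SF) Uw.
  have H1 := is_cdM (is_cd_cst (sg b0) (coord_dir R p) w) (H (k0, true)).
  have H2 := is_cdM (is_cd_cst (2%:R^-1) (coord_dir R p) w)
    (is_cdD (H (k0, false)) H1).
  by rewrite (is_cdE H2) !mul0r !add0r.
rewrite dzE [RHS]dzE !D.
rewrite (cpartialC oU (k, false) (l, false) SF Uw).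
rewrite (cpartialC oU (k, false) (l, true) SF Uw).
rewrite (cpartialC oU (k, true) (l, false) SF Uw).
rewrite (cpartialC oU (k, true) (l, true) SF Uw).
ring.
Qed.

(** The two partial derivatives of a real function are real, so up to sign and a factor 2 they are
    the real and imaginary parts of one Wirtinger derivative. *)
Lemma real_partial0 f p w : smooth_on U f ->
  dz false p.1 (fun z => (f z)%:C) w = 0 -> U w ->
  is_dd f (coord_dir R p) w 0.
Proof.
move=> Sf H Uw; have D q := is_cdE (is_cd_real (smooth_is_dd q Sf Uw)).
have aux (a b : R) : 2%:R^-1 * (a%:C + - 'i%C * b%:C) = 0 -> a = 0 /\ b = 0.
  move=> /eqP; rewrite mulf_eq0 invr_eq0 pnatr_eq0 /= => /eqP E.
  have := congr1 (@complex.Re R) E; have := congr1 (@complex.Im R) E.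
  by rewrite /= => E1 E2; split; lra.
move: H; rewrite dzE !D => /aux[E1 E2].
have := smooth_is_dd p Sf Uw; case: p E1 E2 => k [] /= E1 E2.
- by rewrite E2.
- by rewrite E1.
Qed.

End Wirtinger.

(** * Holomorphic functions and mixed second order jets *)

Section Holomorphic.
Variables (R : realType) (n : nat) (U : set 'rV[R[i]]_n).
Hypothesis oU : open U.
Local Notation V := 'rV[R[i]]_n.
Implicit Types (F G H : V -> R[i]) (w : V).

(** Holomorphy through the Cauchy-Riemann equations, the form in which Wirtinger derivatives are
    computed and interchanged. The complex differentiability of [holomorphic_on] is used for the
    automorphism only. *)
Definition hol F := csmooth U F /\ forall k w, U w -> dz true k F w = 0.

Lemma hol_cst c : hol (fun=> c).
Proof. by split=> [|k w _]; [exact: csmooth_cst | exact: dz_cst]. Qed.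

Lemma hol_coord j : hol (fun z => z 0 j).
Proof. by split=> [|k w _]; [exact: csmooth_coord | rewrite dz_coord]. Qed.

Lemma holD F G : hol F -> hol G -> hol (fun z => F z + G z).
Proof.
move=> [SF F0] [SG G0]; split=> [|k w Uw]; first exact: csmoothD.
by rewrite (dzD _ _ SF SG Uw) F0 // G0 // addr0.
Qed.

Lemma holM F G : hol F -> hol G -> hol (fun z => F z * G z).
Proof.
move=> [SF F0] [SG G0]; split=> [|k w Uw]; first exact: csmoothM.
by rewrite (dzM _ _ SF SG Uw) F0 // G0 // mulr0 mul0r addr0.
Qed.

Lemma holV F : hol F -> (forall w, U w -> F w != 0) -> hol (fun z => (F z)^-1).
Proof.
move=> [SF F0] Fn0; split=> [|k w Uw]; first exact: csmoothV.
by rewrite (dzV oU _ _ SF Fn0 Uw) F0 // oppr0 mul0r.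
Qed.

Lemma hol_sum (I : finType) (P : pred I) (F : I -> V -> R[i]) :
  (forall i, hol (F i)) -> hol (fun z => \sum_(i | P i) F i z).
Proof.
move=> HF; have SF i := (HF i).1; split=> [|k w Uw].
  exact: (csmooth_sum oU).
by rewrite (dz_sum oU _ _ _ SF Uw) big1 // => i _; exact: (HF i).2.
Qed.

Lemma hol_dz k F : hol F -> hol (dz false k F).
Proof.
move=> [SF F0]; split=> [|l w Uw]; first exact: (csmooth_dz oU).
rewrite (dzC oU _ _ _ _ SF Uw).
have S0 := csmooth_dz oU true l SF.
by rewrite (dz_eq_on oU false k S0 (F0 l) Uw) dz_cst.
Qed.

(** These four entries are closed under sums and products: the mixed derivative of a product
    involves no pure second derivative. *)
Definition jet k l H w (a b c d : R[i]) := csmooth U H /\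
  [/\ H w = a, dz false k H w = b, dz true l H w = c &
       dz true l (dz false k H) w = d].

Section JetRules.
Variables (k l : 'I_n) (w : V).
Hypothesis Uw : U w.

Lemma jet_cst a : jet k l (fun=> a) w a 0 0 0.
Proof.
have S := csmooth_cst oU a.
have E z : U z -> dz false k (fun=> a) z = 0 by move=> _; exact: dz_cst.
split=> //; split=> //; rewrite ?dz_cst //.
by rewrite (dz_eq_on oU true l (csmooth_dz oU false k S) E Uw) dz_cst.
Qed.

(** The derivative in w_k meets only [F] and the conjugate derivative in w_l only the conjugate of
    [G], so the mixed derivative is a product of first derivatives. *)
Lemma jet_sesqui F G : hol F -> hol G ->
  jet k l (fun z => F z * cj (G z)) w (F w * cj (G w))
    (dz false k F w * cj (G w)) (F w * cj (dz false l G w))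
    (dz false k F w * cj (dz false l G w)).
Proof.
move=> [SF F0] [SG G0]; have ScG := csmooth_conj oU SG.
have SFG := csmoothM oU SF ScG.
have E1 z : U z -> dz false k (fun z => F z * cj (G z)) z = dz false k F z * cj (G z).
  by move=> Uz; rewrite (dzM _ _ SF ScG Uz) (dz_conj _ _ SG Uz) /= G0 // cj0 mulr0 addr0.
split; first exact: SFG.
split; first by [].
- exact: E1.
- by rewrite (dzM _ _ SF ScG Uw) (dz_conj _ _ SG Uw) /= F0 // mul0r add0r.
have S1 := csmooth_dz oU false k SFG.
rewrite (dz_eq_on oU _ _ S1 E1 Uw).
have [SF' F'0] := hol_dz k (conj SF F0).
by rewrite (dzM _ _ SF' ScG Uw) (dz_conj _ _ SG Uw) /= F'0 // mul0r add0r.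
Qed.

Lemma jetD H G a b c d a' b' c' d' :
  jet k l H w a b c d -> jet k l G w a' b' c' d' ->
  jet k l (fun z => H z + G z) w (a + a') (b + b') (c + c') (d + d').
Proof.
move=> [SH [<- <- <- <-]] [SG [<- <- <- <-]]; split; first exact: (csmoothD oU SH SG).
split; first by [].
- exact: (dzD _ _ SH SG Uw).
- exact: (dzD _ _ SH SG Uw).
have S := csmooth_dz oU false k (csmoothD oU SH SG).
rewrite (dz_eq_on oU true l S (fun z Uz => dzD false k SH SG Uz) Uw).
exact: (dzD _ _ (csmooth_dz oU _ _ SH) (csmooth_dz oU _ _ SG) Uw).
Qed.

Lemma jetM H G a b c d a' b' c' d' :
  jet k l H w a b c d -> jet k l G w a' b' c' d' ->
  jet k l (fun z => H z * G z) w (a * a') (b * a' + a * b') (c * a' + a * c')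
    (d * a' + b * c' + (c * b' + a * d')).
Proof.
move=> [SH [<- <- <- <-]] [SG [<- <- <- <-]]; split; first exact: (csmoothM oU SH SG).
split; first by [].
- exact: (dzM _ _ SH SG Uw).
- exact: (dzM _ _ SH SG Uw).
have S := csmooth_dz oU false k (csmoothM oU SH SG).
rewrite (dz_eq_on oU true l S (fun z Uz => dzM false k SH SG Uz) Uw).
have SH' := csmooth_dz oU false k SH; have SG' := csmooth_dz oU false k SG.
rewrite (dzD _ _ (csmoothM oU SH' SG) (csmoothM oU SH SG') Uw).
by rewrite (dzM _ _ SH' SG Uw) (dzM _ _ SH SG' Uw).
Qed.

Lemma jet_sum (I : finType) (P : pred I) (H : I -> V -> R[i])
    (a b c d : I -> R[i]) :
  (forall i, jet k l (H i) w (a i) (b i) (c i) (d i)) ->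
  jet k l (fun z => \sum_(i | P i) H i z) w (\sum_(i | P i) a i)
    (\sum_(i | P i) b i) (\sum_(i | P i) c i) (\sum_(i | P i) d i).
Proof.
move=> HJ; have SH i := (HJ i).1.
have S := csmooth_sum oU P SH; split; first exact: S.
split.
- by apply: eq_bigr => i _; have [_ []] := HJ i.
- by rewrite (dz_sum oU _ _ _ SH Uw); apply: eq_bigr => i _; have [_ []] := HJ i.
- by rewrite (dz_sum oU _ _ _ SH Uw); apply: eq_bigr => i _; have [_ []] := HJ i.
rewrite (dz_eq_on oU true l (csmooth_dz oU _ _ S)
  (fun z Uz => dz_sum oU false k P SH Uz) Uw).
rewrite (dz_sum oU _ _ _ (fun i => csmooth_dz oU false k (SH i)) Uw).
by apply: eq_bigr => i _; have [_ []] := HJ i.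
Qed.

(** Used to differentiate an identity valid on [U]: the jets computed separately for its two sides
    are compared entry by entry. *)
Lemma jet_eq_on H G a b c d a' b' c' d' : (forall z, U z -> H z = G z) ->
  jet k l H w a b c d -> jet k l G w a' b' c' d' ->
  [/\ a = a', b = b', c = c' & d = d'].
Proof.
move=> HG [SH [<- <- <- <-]] [SG [<- <- <- <-]]; split; first exact: HG.
- exact: (dz_eq_on oU _ _ SH HG Uw).
- exact: (dz_eq_on oU _ _ SH HG Uw).
apply: (dz_eq_on oU _ _ (csmooth_dz oU _ _ SH) _ Uw) => z Uz.
exact: (dz_eq_on oU _ _ SH HG Uz).
Qed.

End JetRules.
End Holomorphic.

(** * The defining function of the Siegel domain *)

Section SiegelDomain.
Variables (R : realType) (m : nat).
Local Notation V := 'rV[R[i]]_m.+1.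
Local Notation N := (@ord_max m).
Local Notation U := (siegel R m).
Implicit Types (w z : V).

(* The defining function in sesquilinear form. *)
Definition rhoC z : R[i] :=
  2%:R^-1 * (z 0 N * cj 1 + 1 * cj (z 0 N)) +
  -1 * \sum_(j < m.+1 | j != N) z 0 j * cj (z 0 j).

Lemma rhoCE z : rhoC z = (siegel_rho z)%:C.
Proof.
rewrite /rhoC /siegel_rho rmorphB /= rmorph_sum /= mulN1r; congr (_ - _).
  case: (z 0 N) => a b; rewrite cj1 mulr1 mul1r /cj /=.
  apply/eqP; rewrite eq_complex /=; apply/andP; split; apply/eqP; [by field | by ring].
apply: eq_bigr => j _; case: (z 0 j) => a b; rewrite /cj /=.
by apply/eqP; rewrite eq_complex /=; apply/andP; split; apply/eqP; ring.
Qed.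

Lemma csmooth_rhoC (W : set V) : open W -> csmooth W rhoC.
Proof.
move=> oW; have Sc j := csmooth_coord oW j; have Sk c := csmooth_cst oW c.
apply: (csmoothD oW); apply: (csmoothZ oW).
  apply: (csmoothD oW); apply: (csmoothM oW) => //; exact: csmooth_conj.
apply: (csmooth_sum oW) => j; apply: (csmoothM oW) => //; exact: csmooth_conj.
Qed.

Lemma smooth_rho (W : set V) : open W -> smooth_on W (@siegel_rho R m).
Proof.
move=> /csmooth_rhoC[S _].
have -> : @siegel_rho R m = fun z => complex.Re (rhoC z).
  by apply/funext => z; rewrite rhoCE.
exact: S.
Qed.

Lemma open_siegel : open U.
Proof.
have -> : U = @siegel_rho R m @^-1` [set x | 0 < x] by [].
apply: open_comp; last exact: open_gt.
move=> w _; exact: (smooth_continuous (smooth_rho openT) I).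
Qed.

Local Notation oU := open_siegel.

Definition drho w k : R[i] := if k == N then 2%:R^-1 else - cj (w 0 k).

Lemma jet_rho k l w : U w ->
  jet U k l rhoC w (rhoC w) (drho w k) (cj (drho w l))
    (if k == N then 0 else - (k == l)%:R).
Proof.
move=> Uw.
have Jc c := jet_cst oU k l Uw c; have Hc j := hol_coord oU j.
(* Pairing w_n with the constant 1 brings the linear terms of rho under [jet_sesqui]. *)
have H1 := hol_cst oU 1.
have := jetD oU Uw (jetM oU Uw (Jc 2%:R^-1)
    (jetD oU Uw (jet_sesqui oU k l Uw (Hc N) H1) (jet_sesqui oU k l Uw H1 (Hc N))))
  (jetM oU Uw (Jc (-1)) (jet_sum oU Uw (fun j => j != N)
    (fun j => jet_sesqui oU k l Uw (Hc j) (Hc j)))).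
have HD (F : 'I_m.+1 -> R[i]) i :
    \sum_(j < m.+1 | j != N) (i == j)%:R * F j = if i == N then 0 else F i.
  have [->|iN] := eqVneq i N.
    by rewrite big1 // => j jN; rewrite eq_sym (negbTE jN) mul0r.
  rewrite (bigD1 i) //= eqxx mul1r big1 ?addr0 // => j /andP[_ ji].
  by rewrite eq_sym (negbTE ji) mul0r.
rewrite !dz_cst !dz_coord /= !cj1 !cj0 !mul0r !mulr0 !mulr1 !mul1r !add0r !addr0.
have -> : \sum_(j < m.+1 | j != N) dz false k (fun z : V => z 0 j) w * cj (w 0 j) =
   if k == N then 0 else cj (w 0 k).
  by rewrite -(HD (fun j => cj (w 0 j)) k); apply: eq_bigr => j _; rewrite dz_coord.
have -> : \sum_(j < m.+1 | j != N) w 0 j * cj (dz false l (fun z : V => z 0 j) w) =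
   if l == N then 0 else w 0 l.
  by rewrite -(HD (fun j => w 0 j) l); apply: eq_bigr => j _; rewrite dz_coord cj_nat mulrC.
have -> : \sum_(j < m.+1 | j != N) dz false k (fun z : V => z 0 j) w *
    cj (dz false l (fun z : V => z 0 j) w) = if k == N then 0 else (k == l)%:R.
  rewrite [k == l]eq_sym -(HD (fun j => (l == j)%:R) k); apply: eq_bigr => j _.
  by rewrite !dz_coord cj_nat.
have -> : 2%:R^-1 * (k == N)%:R + -1 * (if k == N then 0 else cj (w 0 k)) = drho w k.
  by rewrite /drho; case: eqP => _; rewrite ?mulr1 ?mulr0 ?addr0 ?add0r ?mulN1r.
have -> : 2%:R^-1 * cj (l == N)%:R + -1 * (if l == N then 0 else w 0 l) = cj (drho w l).
  rewrite /drho; case: eqP => _; rewrite cj_nat ?cjN ?cjK ?mulr1 ?mulr0 ?addr0 ?add0r ?mulN1r //.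
  by rewrite cjV cj_nat.
have -> : -1 * (if k == N then 0 else (k == l)%:R) =
    (if k == N then 0 else - (k == l)%:R) :> R[i].
  by case: eqP; rewrite ?mulr0 ?mulN1r.
rewrite mulr0 add0r.
rewrite (_ : @rhoC = fun z : V => 2%:R^-1 * (z 0 N * 1 + 1 * cj (z 0 N)) +
    -1 * \sum_(j < m.+1 | j != N) z 0 j * cj (z 0 j)) /= ?mulr1 ?mul1r //.
by apply/funext => z; rewrite /rhoC cj1.
Qed.

End SiegelDomain.

(** * The Bergman metric of the Siegel domain *)

Section JetLn.
Variables (R : realType) (n : nat) (U : set 'rV[R[i]]_n).
Hypothesis oU : open U.
Variables (f : 'rV[R[i]]_n -> R) (k l : 'I_n) (w : 'rV[R[i]]_n).

Lemma jet_ln a b c d : smooth_on U f -> (forall z, U z -> 0 < f z) -> U w ->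
  jet U k l (fun z => (f z)%:C) w a b c d ->
  jet U k l (fun z => (ln (f z))%:C) w (ln (f w))%:C (b / a) (c / a)
    (d / a - b * c / a ^+ 2).
Proof.
move=> Sf f0 Uw [SF [<- <- <- <-]].
have S := csmooth_real oU (smooth_ln oU Sf f0).
have fn0 z : U z -> (f z)%:C != 0 by move=> Uz; rewrite fmorph_eq0 gt_eqF ?f0.
split; first exact: S.
split; first by [].
- exact: (dz_ln _ _ Sf f0 Uw).
- exact: (dz_ln _ _ Sf f0 Uw).
rewrite (dz_eq_on oU true l (csmooth_dz oU false k S)
  (fun z Uz => dz_ln false k Sf f0 Uz) Uw).
have SF' := csmooth_dz oU false k SF; have SV := csmoothV oU SF fn0.
rewrite (dzM _ _ SF' SV Uw) (dzV oU _ _ SF fn0 Uw) mulrA; congr (_ + _).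
by rewrite mulrN mulNr.
Qed.

End JetLn.

Section MetricAlgebra.
Variables (R : realType) (m : nat).
Local Notation N := (@ord_max m).
Implicit Types (v x : 'I_m.+1 -> R[i]).

Lemma sum_pick (P : pred 'I_m.+1) (F : 'I_m.+1 -> R[i]) i : P i ->
  \sum_(j < m.+1 | P j) (i == j)%:R * F j = F i.
Proof.
move=> Pi; rewrite (bigD1 i) //= eqxx mul1r big1 ?addr0 // => j /andP[_ ji].
by rewrite eq_sym (negbTE ji) mul0r.
Qed.

Variables (w : 'rV[R[i]]_m.+1).
Local Notation rho := (rhoC w).
Local Notation r := (drho w).

Definition re2 : R[i] := w 0 N + cj (w 0 N).
Definition sqn' : R[i] := \sum_(j < m.+1 | j != N) w 0 j * cj (w 0 j).

Lemma rho_re2 : 2%:R * rho = re2 - 2%:R * sqn'.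
Proof. by rewrite /rhoC cj1 /re2 /sqn'; field. Qed.

(* The inverse of the metric, up to the factor [rho / (m + 2)]. *)
Definition coH (k j : 'I_m.+1) : R[i] :=
  if k == N then (if j == N then 2%:R * re2 else 2%:R * cj (w 0 j))
  else (if j == N then 2%:R * w 0 k else (k == j)%:R).

(** Raising the index of the conjugate differential of rho gives a multiple of the direction w_n.
    This is how [coH] handles the rank one part of the metric. *)
Lemma sum_coH_cjr k : \sum_j coH k j * cj (r j) = 2%:R * rho * (k == N)%:R.
Proof.
rewrite (bigD1 N) //= /drho eqxx /= cjV cj_nat /coH eqxx.
have [kN|kN] := eqVneq k N.
  rewrite mulr1 rho_re2.
  rewrite (eq_bigr (fun j => -2%:R * (w 0 j * cj (w 0 j)))) => [|j jN].
    by rewrite -mulr_sumr -/sqn'; field.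
  by rewrite (negbTE jN) cjN cjK; ring.
rewrite mulr0 (eq_bigr (fun j => (k == j)%:R * - w 0 j)) => [|j jN].
  by rewrite (sum_pick _ kN); field.
by rewrite (negbTE jN) cjN cjK.
Qed.

Lemma coH_herm k j : coH j k = cj (coH k j).
Proof.
rewrite /coH; case: (eqVneq k N) => kN; case: (eqVneq j N) => jN.
- by rewrite cjM cj_nat /re2 cjD cjK [_ + w 0 N]addrC.
- by rewrite cjM cj_nat cjK.
- by rewrite cjM cj_nat.
- by rewrite cj_nat eq_sym.
Qed.

Lemma cj_rhoC : cj rho = rho.
Proof. by rewrite rhoCE cj_real. Qed.

Lemma sum_r_coH j : \sum_k r k * coH k j = 2%:R * rho * (j == N)%:R.
Proof.
have -> : 2%:R * rho * (j == N)%:R = cj (2%:R * rho * (j == N)%:R).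
  by rewrite !cjM !cj_nat cj_rhoC.
rewrite -sum_coH_cjr cj_sum.
by apply: eq_bigr => k _; rewrite cjM cjK -coH_herm mulrC.
Qed.

Definition euler x : R[i] := \sum_j w 0 j * x j.

(* [rho * defect] is the deviation from the canonical potential of the squared
   length of the gradient. *)
Definition defect x : R[i] :=
  \sum_(j < m.+1 | j != N) x j * cj (x j) +
  2%:R * (x N * cj (euler x - 1) + (euler x - 1) * cj (x N)).

(** The two linear terms are the contribution of the constant -1 in [euler x - 1]; the rest of
    [defect] is the hermitian form of [coH]. *)
Lemma coH_form x :
  \sum_k \sum_j coH k j * x k * cj (x j) - 2%:R * x N - 2%:R * cj (x N) = defect x.
Proof.
pose M := \sum_(j < m.+1 | j != N) w 0 j * x j.
pose B := \sum_(j < m.+1 | j != N) x j * cj (x j).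
have eM : euler x = w 0 N * x N + M by rewrite /euler (bigD1 N).
have TN : \sum_j coH N j * x N * cj (x j) =
    2%:R * re2 * x N * cj (x N) + 2%:R * x N * cj M.
  rewrite (bigD1 N) //= /coH !eqxx; congr (_ + _).
  rewrite cj_sum mulr_sumr; apply: eq_bigr => j jN.
  by rewrite (negbTE jN) cjM; ring.
have Tk k : k != N -> \sum_j coH k j * x k * cj (x j) =
    2%:R * cj (x N) * (w 0 k * x k) + x k * cj (x k).
  move=> kN; rewrite (bigD1 N) //= /coH (negbTE kN) eqxx; congr (_ + _); first by ring.
  rewrite (eq_bigr (fun j => (k == j)%:R * (x k * cj (x j)))) => [|j jN].
    by rewrite (sum_pick _ kN).
  by rewrite (negbTE jN) mulrA.
rewrite (bigD1 N) //= TN (eq_bigr _ Tk) big_split /= -mulr_sumr -/M -/B.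
rewrite /defect -/B eM /re2 !cjD cjN cj1 cjM.
move: (x N) (cj (x N)) (w 0 N) (cj (w 0 N)) M (cj M) B {eM TN Tk}.
by move=> a a' t t' M M' B; ring.
Qed.

Hypothesis rho0 : rho != 0.

Definition metric_coeff i j : R[i] := m.+2%:R *
  (r i * cj (r j) / rho ^+ 2 - (if i == N then 0 else - (i == j)%:R) / rho).

(** The rank one term contributes only for k = N, by [sum_coH_cjr], and the diagonal term only for i
    != N; where both are present they cancel. *)
Lemma metric_coeff_inv i k :
  \sum_j metric_coeff i j * (m.+2%:R^-1 * rho * coH k j) = (i == k)%:R.
Proof.
have c0 : m.+2%:R != 0 :> R[i] by rewrite pnatr_eq0.
have -> : \sum_j metric_coeff i j * (m.+2%:R^-1 * rho * coH k j) =
    r i / rho * (\sum_j coH k j * cj (r j)) +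
    \sum_j (i == j)%:R * (if i == N then 0 else coH k j).
  rewrite mulr_sumr -big_split /=; apply: eq_bigr => j _; rewrite /metric_coeff.
  move: c0 rho0; move: (m.+2%:R : R[i]) rho (coH k j) (cj (r j)) (r i) (i == j)%:R.
  by case: (i == N) => c t h x y b c0 t0; field; rewrite c0 t0.
rewrite sum_coH_cjr sum_pick //.
rewrite (_ : r i / rho * (2%:R * rho * (k == N)%:R) = 2%:R * r i * (k == N)%:R);
  last by field.
rewrite /drho /coH.
have [iE|iN] := eqVneq i N; have [kE|kN] := eqVneq k N.
- by rewrite iE kE eqxx addr0 mulr1 divff // pnatr_eq0.
- by rewrite iE mulr0 addr0 eq_sym (negbTE kN).
- by rewrite kE (negbTE iN) /= mulr1; ring.
- by rewrite mulr0 add0r eq_sym.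
Qed.

(** Here [b] has the shape that [dz_pot] gives to the differential of a potential. In the expansion
    the terms in [r] collapse, by [sum_coH_cjr] and [sum_r_coH], to the linear terms of [coH_form]
    and to the constant 1. *)
Lemma metric_length x :
  let b k := m.+2%:R * (x k - r k / rho) in
  \sum_k \sum_j m.+2%:R^-1 * rho * coH k j * b k * cj (b j) =
  m.+2%:R * (1 + rho * defect x).
Proof.
move=> b.
have c0 : m.+2%:R != 0 :> R[i] by rewrite pnatr_eq0.
pose T k := \sum_j coH k j * cj (x j).
have E1 k : \sum_j m.+2%:R^-1 * rho * coH k j * b k * cj (b j) =
    m.+2%:R * rho * ((x k - r k / rho) * (T k - 2%:R * (k == N)%:R)).
  have -> : T k - 2%:R * (k == N)%:R = \sum_j coH k j * (cj (x j) - cj (r j) / rho).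
    rewrite (eq_bigr (fun j => coH k j * cj (x j) - rho^-1 * (coH k j * cj (r j)))).
      rewrite big_split /= sumrN -mulr_sumr sum_coH_cjr; congr (_ - _).
      by field.
    by move=> j _; ring.
  rewrite mulrA mulr_sumr; apply: eq_bigr => j _.
  rewrite /b cjM cj_nat cjD cjN cjM cjV cj_rhoC.
  move: c0 rho0; move: (m.+2%:R : R[i]) rho (coH k j) (cj (r j)) (r k) => c t h y z c0 t0.
  by field; rewrite c0 t0.
rewrite (eq_bigr _ (fun k _ => E1 k)) -mulr_sumr -mulrA; congr (_ * _).
have -> : 1 + rho * defect x = rho * (rho^-1 + defect x) by field.
congr (_ * _); rewrite -coH_form.
have ET k : x k * T k = \sum_j coH k j * x k * cj (x j).
  by rewrite /T mulr_sumr; apply: eq_bigr => j _; ring.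
rewrite -(eq_bigr _ (fun k _ => ET k)).
have Er : \sum_k r k * T k = 2%:R * rho * cj (x N).
  transitivity (\sum_k \sum_j r k * coH k j * cj (x j)).
    by apply: eq_bigr => k _; rewrite mulr_sumr; apply: eq_bigr => j _; ring.
  rewrite exchange_big /= (eq_bigr (fun j => (N == j)%:R * (2%:R * rho * cj (x j)))).
    by rewrite sum_pick.
  by move=> j _; rewrite -mulr_suml sum_r_coH eq_sym; ring.
have E2 k : (x k - r k / rho) * (T k - 2%:R * (k == N)%:R) =
    x k * T k + (- rho^-1) * (r k * T k) +
    (N == k)%:R * (-2%:R * (x k - r k / rho)).
  by rewrite [N == k]eq_sym; ring.
rewrite (eq_bigr _ (fun k _ => E2 k)) !big_split /= -mulr_sumr Er sum_pick //.
rewrite {1}/drho eqxx.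
move: rho0; move: rho (\sum_k _) (x N) (cj (x N)) => t S a a' t0.
by field.
Qed.

End MetricAlgebra.

(** * Kähler potentials of the metric and the length of their gradient *)

Section Potential.
Variables (R : realType) (m : nat).
Local Notation V := 'rV[R[i]]_m.+1.
Local Notation N := (@ord_max m).
Local Notation U := (siegel R m).
Local Notation oU := (@open_siegel R m).
Local Notation c := (m.+2%:R : R[i]).
Implicit Types (w z : V) (phi : V -> R).

Lemma siegel_rho_gt0 w : U w -> 0 < siegel_rho w. Proof. by []. Qed.

Lemma rhoC_neq0 w : U w -> rhoC w != 0.
Proof. by move=> Uw; rewrite rhoCE fmorph_eq0 gt_eqF ?siegel_rho_gt0. Qed.

Lemma ln_psi0 w : U w -> ln (psi0 w) = - m.+2%:R * ln (siegel_rho w).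
Proof.
move=> Uw; have r0 := siegel_rho_gt0 Uw.
by rewrite /psi0 lnV ?posrE ?exprn_gt0 // lnXn // mulNr mulr_natl.
Qed.

Lemma jet_ln_rho k l w : U w ->
  jet U k l (fun z => (ln (siegel_rho z))%:C) w (ln (siegel_rho w))%:C
    (drho w k / rhoC w) (cj (drho w l) / rhoC w)
    ((if k == N then 0 else - (k == l)%:R) / rhoC w -
     drho w k * cj (drho w l) / rhoC w ^+ 2).
Proof.
move=> Uw; have J := jet_rho k l Uw.
have E : @rhoC R m = fun z => (siegel_rho z)%:C by apply/funext => z; exact: rhoCE.
rewrite {1}E in J.
exact: (jet_ln oU (smooth_rho oU) siegel_rho_gt0 Uw J).
Qed.

Lemma ddbarE phi i j w : smooth_on U phi -> U w ->
  ddbar phi w i j = dz true j (dz false i (fun z => (phi z)%:C)) w.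
Proof.
move=> Sphi Uw; rewrite -(dzC oU _ _ _ _ (csmooth_real oU Sphi) Uw).
by rewrite mxE dz.unlock.
Qed.

Lemma siegel_metricE i j w : U w -> siegel_metric w i j = metric_coeff w i j.
Proof.
move=> Uw.
have J := jetM oU Uw (jet_cst oU i j Uw (- c)) (jet_ln_rho i j Uw).
have SL := J.1.
have E z : U z -> - c * (ln (siegel_rho z))%:C = (ln (psi0 z))%:C.
  by move=> Uz; rewrite (ln_psi0 Uz) rmorphM rmorphN rmorph_nat.
rewrite /siegel_metric mxE.
(* [ddbar] takes the conjugate derivative first and [jet] takes it last, so the order has to be
   exchanged. *)
transitivity (dz false i (dz true j (fun z => (ln (psi0 z))%:C)) w).
  by rewrite dz.unlock.
rewrite -(dz_eq_on oU false i (csmooth_dz oU true j SL)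
  (fun z Uz => dz_eq_on oU true j SL E Uz) Uw) (dzC oU _ _ _ _ SL Uw).
have [_ [_ _ _ ->]] := J; rewrite /metric_coeff.
by rewrite !mul0r !add0r; ring.
Qed.

Lemma dz_real_conj k phi w : smooth_on U phi -> U w ->
  dz true k (fun z => (phi z)%:C) w = cj (dz false k (fun z => (phi z)%:C) w).
Proof.
move=> Sphi Uw; have S := csmooth_real oU Sphi.
rewrite -(dz_conj true k S Uw).
by have -> : (fun z => cj (phi z)%:C) = (fun z => (phi z)%:C)
  by apply/funext => z; exact: cj_real.
Qed.

(* The normalized holomorphic part of the difference between [phi] and the
   canonical potential. *)
Definition hpart phi k z : R[i] := c^-1 *
  dz false k (fun z => (phi z)%:C + c * (ln (siegel_rho z))%:C) z.

Lemma csmooth_pot phi : smooth_on U phi ->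
  csmooth U (fun z => (phi z)%:C + c * (ln (siegel_rho z))%:C).
Proof.
move=> Sphi; apply: (csmoothD oU (csmooth_real oU Sphi)).
apply: (csmoothZ oU); apply: (csmooth_real oU).
exact: (smooth_ln oU (smooth_rho oU) siegel_rho_gt0).
Qed.

Lemma dz_pot phi k w : smooth_on U phi -> U w ->
  dz false k (fun z => (phi z)%:C) w = c * (hpart phi k w - drho w k / rhoC w).
Proof.
move=> Sphi Uw; have S := csmooth_real oU Sphi.
have c0 : c != 0 by rewrite pnatr_eq0.
have [SL [_ E _ _]] := jet_ln_rho k k Uw.
rewrite /hpart (dzD _ _ S (csmoothZ oU _ SL) Uw) (dzZ oU _ _ _ SL Uw) E.
by rewrite mulrBr mulVKf // addrK.
Qed.

Lemma hpart_sym phi i j w : smooth_on U phi -> U w ->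
  dz false i (hpart phi j) w = dz false j (hpart phi i) w.
Proof.
move=> Sphi Uw; have S := csmooth_pot Sphi.
rewrite (dzZ oU _ _ _ (csmooth_dz oU false j S) Uw).
rewrite (dzZ oU _ _ _ (csmooth_dz oU false i S) Uw).
by rewrite (dzC oU false i false j S Uw).
Qed.

(** Up to a factor, the conjugate derivatives are the entries of the difference between [ddbar phi]
    and the metric, and this difference is zero for a potential. *)
Lemma hol_hpart phi k : smooth_on U phi ->
  kahler_potential U (@siegel_metric R m) phi -> hol U (hpart phi k).
Proof.
move=> Sphi Kphi; have S := csmooth_pot Sphi; have S' := csmooth_dz oU false k S.
split; first exact: (csmoothZ oU).
move=> l w Uw; rewrite (dzZ oU _ _ _ S' Uw).
have [SL [_ _ _ EL]] := jet_ln_rho k l Uw.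
have Sp := csmooth_real oU Sphi; have ScL := csmoothZ oU c SL.
rewrite (dz_eq_on oU true l S' (fun z Uz => dzD false k Sp ScL Uz) Uw).
rewrite (dzD _ _ (csmooth_dz oU _ _ Sp) (csmooth_dz oU _ _ ScL) Uw).
rewrite -(ddbarE k l Sphi Uw) Kphi // siegel_metricE //.
rewrite (dz_eq_on oU true l (csmooth_dz oU _ _ ScL) (fun z Uz => dzZ oU false k c SL Uz) Uw).
rewrite (dzZ oU _ _ _ (csmooth_dz oU _ _ SL) Uw) EL /metric_coeff.
by apply/eqP; rewrite mulf_eq0; apply/orP; right; apply/eqP; ring.
Qed.

Lemma inv_siegel_metric k j w : U w ->
  inv_metric (siegel_metric w) k j = c^-1 * rhoC w * coH w k j.
Proof.
move=> Uw; pose G := \matrix_(j, k) (c^-1 * rhoC w * coH w k j).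
have gG : siegel_metric w *m G = 1%:M.
  apply/matrixP => a b; rewrite mxE [RHS]mxE -(metric_coeff_inv (rhoC_neq0 Uw)).
  by apply: eq_bigr => t _; rewrite siegel_metricE // mxE.
(* A right inverse makes the matrix a unit; on a singular matrix [invmx] would return its
   argument. *)
have [gu _] := mulmx1_unit gG.
have -> : inv_metric (siegel_metric w) = G^T.
  by rewrite /inv_metric -[G]mul1mx -(mulVmx gu) -mulmxA gG mulmx1.
by rewrite !mxE.
Qed.

Lemma dnorm2E phi w : smooth_on U phi -> U w ->
  dnorm2 (@siegel_metric R m) phi w =
  c * (1 + rhoC w * defect w (fun k => hpart phi k w)).
Proof.
move=> Sphi Uw; rewrite -(metric_length (rhoC_neq0 Uw)).
apply: eq_bigr => k _; apply: eq_bigr => j _.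
rewrite inv_siegel_metric //.
have -> : wirtinger k (fun z => (phi z)%:C) w = dz false k (fun z => (phi z)%:C) w.
  by rewrite dz.unlock.
have -> : wirtinger_bar j (fun z => (phi z)%:C) w = dz true j (fun z => (phi z)%:C) w.
  by rewrite dz.unlock.
by rewrite dz_real_conj // !dz_pot.
Qed.

End Potential.

(** * Functions with vanishing derivatives *)

Section Constancy.
Variables (R : realType) (m : nat).
Local Notation V := 'rV[R[i]]_m.+1.
Local Notation N := (@ord_max m).
Local Notation U := (siegel R m).
Local Notation dir := (coord_dir R).
Implicit Types (w z v : V).

(** The domain is convex because rho, a real linear form minus a sum of squares, is concave. *)
Lemma siegel_segment z v (t : R) : 0 <= t <= 1 -> U z -> U (z + v) ->
  U (z + t%:C *: v).
Proof.
move=> /andP[t0 t1]; rewrite /siegel /= => Hz Hv.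
suff H : (1 - t) * siegel_rho z + t * siegel_rho (z + v) <= siegel_rho (z + t%:C *: v).
  apply: lt_le_trans H; have [->|tn0] := eqVneq t 0.
    by rewrite subr0 mul1r mul0r addr0.
  apply: ltr_wpDl; first by apply: mulr_ge0; [rewrite subr_ge0 | exact: ltW].
  by rewrite mulr_gt0 // lt0r tn0.
have sq (x y : R) : (x + t * y) ^+ 2 <= (1 - t) * x ^+ 2 + t * (x + y) ^+ 2.
  rewrite -subr_ge0 (_ : _ - _ = t * (1 - t) * y ^+ 2); last by ring.
  by rewrite mulr_ge0 ?sqr_ge0 // mulr_ge0 // subr_ge0.
have ReZ (x : R[i]) : complex.Re (t%:C * x) = t * complex.Re x.
  by case: x => a b /=; ring.
have ImZ (x : R[i]) : complex.Im (t%:C * x) = t * complex.Im x.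
  by case: x => a b /=; ring.
rewrite /siegel_rho !mxE !ReD ReZ.
rewrite !mulrBr (_ : forall a b c d : R, a - b + (c - d) = a + c - (b + d));
  last by move=> *; ring.
apply: lerB.
  by rewrite le_eqVlt; apply/orP; left; apply/eqP; ring.
rewrite !mulr_sumr -big_split /=; apply: ler_sum => j _.
rewrite !mxE !ReD !ImD ReZ ImZ.
move: (complex.Re (z 0 j)) (complex.Re (v 0 j)) (complex.Im (z 0 j)) (complex.Im (v 0 j)).
move=> a b c d; have := sq a b; have := sq c d; lra.
Qed.

Section RealFunction.
Variable f : V -> R.
Hypothesis Df : forall p w, U w -> is_dd f (dir p) w 0.

Lemma const_coord z p (s : R) : U z -> U (z + s%:C *: dir p) ->
  f (z + s%:C *: dir p) = f z.
Proof.
move=> Uz Us; have [->|s0] := eqVneq s 0; first by rewrite scale0r addr0.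
pose F (t : R) := f (z + (t * s)%:C *: dir p).
have Ut (t : R) : 0 <= t <= 1 -> U (z + (t * s)%:C *: dir p).
  by move=> ht; rewrite rmorphM -scalerA; exact: siegel_segment.
have DF (t : R) : 0 <= t <= 1 -> is_derive t (1 : R) F 0.
  move=> ht; have H := is_dd_line (Df p (Ut t ht)).
  have D : is_derive t (1 : R) (fun t : R => t * s) s.
    rewrite (_ : (fun t : R => t * s) = s \*: (id : R -> R)).
      by apply: is_derive_eq; rewrite /GRing.scale /= mulr1.
    by apply/funext => x; rewrite /= mulrC.
  have := @is_derive1_comp _ (fun t => f (z + t%:C *: dir p)) (fun t => t * s) t 0 s H D.
  by rewrite mul0r.
have sub (x : R) : x \in `]0, 1[ -> 0 <= x <= 1.
  by rewrite in_itv /= => /andP[x0 x1]; rewrite !ltW.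
have sub' (x : R) : x \in `[0, 1] -> 0 <= x <= 1 by rewrite in_itv.
have [|t /sub ht] := @MVT R F (fun=> 0) 0 1 ltr01 (fun x hx => DF x (sub x hx)).
  apply: derivable_within_continuous => x /sub' hx.
  by have [] := DF x hx.
by rewrite mul0r /F mul1r mul0r scale0r addr0 => /eqP; rewrite subr_eq0 => /eqP.
Qed.

Lemma siegel_shrink z z' : U z ->
  complex.Re (z 0 N) <= complex.Re (z' 0 N) ->
  (forall j, j != N -> complex.Re (z' 0 j) ^+ 2 <= complex.Re (z 0 j) ^+ 2) ->
  (forall j, j != N -> complex.Im (z' 0 j) ^+ 2 <= complex.Im (z 0 j) ^+ 2) -> U z'.
Proof.
rewrite /siegel /= => Uz H1 H2 H3; apply: lt_le_trans Uz _; apply: lerB => //.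
by apply: ler_sum => j jN; apply: lerD; [exact: H2 | exact: H3].
Qed.

Lemma coord_dirE (p : 'I_m.+1 * bool) j :
  dir p 0 j = if j == p.1 then (if p.2 then 'i%C else 1) else 0.
Proof.
by rewrite /coord_dir !mxE eqxx /=; case: (j == _); rewrite ?mulr1 ?mulr0.
Qed.

(** One coordinate is changed along two axis-parallel segments, the real part first; the first
    membership hypothesis is that the corner lies in the domain. *)
Lemma const_replace z j (a : R[i]) : U z ->
  U (\row_i (if i == j then complex.Re a +i* complex.Im (z 0 i) else z 0 i)) ->
  U (\row_i (if i == j then a else z 0 i)) ->
  f (\row_i (if i == j then a else z 0 i)) = f z.
Proof.
move=> Uz U1 U2.
have e1 : \row_i (if i == j then complex.Re a +i* complex.Im (z 0 i) else z 0 i) =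
    z + (complex.Re a - complex.Re (z 0 j))%:C *: dir (j, false).
  apply/rowP => i; rewrite mxE [RHS]mxE [X in _ = _ + X]mxE coord_dirE /=.
  case: (eqVneq i j) => [->|_]; last by rewrite mulr0 addr0.
  by rewrite mulr1; apply/eqP; rewrite eq_complex; case: (z 0 j) => x y /=;
    rewrite addr0 eqxx andbT addrC subrK.
have e2 : \row_i (if i == j then a else z 0 i) =
    \row_i (if i == j then complex.Re a +i* complex.Im (z 0 i) else z 0 i)
    + (complex.Im a - complex.Im (z 0 j))%:C *: dir (j, true).
  apply/rowP => i; rewrite mxE [RHS]mxE [X in _ = X + _]mxE.
  rewrite [X in _ = _ + X]mxE coord_dirE /=.
  case: (eqVneq i j) => [->|_]; last by rewrite mulr0 addr0.
  apply/eqP; rewrite eq_complex; case: a {U1 U2 e1} => c d; case: (z 0 j) => x y /=.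
  by apply/andP; split; apply/eqP; ring.
rewrite e2 in U2 *; rewrite const_coord //.
by rewrite e1 in U1 *; exact: const_coord.
Qed.

Lemma siegel_baseE (j : 'I_m.+1) : siegel_base R m 0 j = (j == N)%:R.
Proof. by rewrite mxE eqxx. Qed.

Lemma siegel_base_in : U (siegel_base R m).
Proof.
rewrite /siegel /= /siegel_rho siegel_baseE eqxx big1 ?subr0 ?ltr01 // => j jN.
by rewrite siegel_baseE (negbTE jN) /= expr0n addr0.
Qed.

Lemma const_siegel z : U z -> f z = f (siegel_base R m).
Proof.
move=> Uz.
(* The coordinates of w' are set to zero one at a time, which never decreases rho. The index stops
   at [m], leaving w_n untouched; w_n is moved to 1 at the end. *)
pose zk k : V := \row_j (if (j < k)%N then 0 else z 0 j).
have Uk k : (k <= m)%N -> U (zk k).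
  move=> km; apply: (siegel_shrink Uz) => [|j jN|j jN]; rewrite !mxE /=.
  - by rewrite ltnNge km.
  - by case: ifP => //= _; rewrite expr0n sqr_ge0.
  - by case: ifP => //= _; rewrite expr0n sqr_ge0.
have step k : (k <= m)%N -> f (zk k) = f z.
  elim: k => [_|k IH km].
    by congr f; apply/rowP => j; rewrite mxE.
  rewrite -(IH (ltnW km)).
  have kn : (k < m.+1)%N by rewrite ltnW.
  have e : zk k.+1 = \row_i (if i == Ordinal kn then 0 else zk k 0 i).
    apply/rowP => i; rewrite !mxE ltnS leq_eqVlt -val_eqE /=.
    by case: (val i == k).
  have kN : Ordinal kn != N by rewrite -val_eqE /= neq_ltn km.
  rewrite e; apply: const_replace; first exact: Uk (ltnW km).
    apply: (siegel_shrink (Uk k (ltnW km))) => [|j jN|j jN].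
    - by rewrite [in X in _ <= X]mxE eq_sym (negbTE kN).
    - by rewrite [in X in X <= _]mxE; case: eqP => //= _; rewrite expr0n sqr_ge0.
    - by rewrite [in X in X <= _]mxE; case: eqP.
  by rewrite -e; exact: Uk.
rewrite -(step m (leqnn m)).
have e : siegel_base R m = \row_i (if i == N then 1 else zk m 0 i).
  apply/rowP => i; rewrite siegel_baseE !mxE; case: eqVneq => [//|iN].
  rewrite (_ : (i < m)%N) //; move: iN (ltn_ord i).
  by rewrite -val_eqE /= ltnS leq_eqVlt => /negbTE ->.
rewrite [in RHS]e; apply/esym/const_replace; first exact: Uk.
  apply: (siegel_shrink siegel_base_in) => [|j jN|j jN].
  - by rewrite [in X in _ <= X]mxE siegel_baseE eqxx.
  - rewrite [in X in X <= _]mxE (negbTE jN) mxE (_ : (j < m)%N) /= ?expr0n ?sqr_ge0 //.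
    by move: jN (ltn_ord j); rewrite -val_eqE /= ltnS leq_eqVlt => /negbTE ->.
  - rewrite [in X in X <= _]mxE (negbTE jN) mxE (_ : (j < m)%N) /= ?expr0n ?sqr_ge0 //.
    by move: jN (ltn_ord j); rewrite -val_eqE /= ltnS leq_eqVlt => /negbTE ->.
by rewrite -e; exact: siegel_base_in.
Qed.

End RealFunction.

Lemma csmooth_const F : csmooth U F ->
  (forall b k w, U w -> dz b k F w = 0) ->
  forall z, U z -> F z = F (siegel_base R m).
Proof.
move=> SF F0 z Uz.
have D p w : U w -> cpartial p F w = 0.
  move=> Uw; have := F0 true p.1 w Uw; have := F0 false p.1 w Uw.
  rewrite !dzE => H1 H2.
  have aux (a b : R[i]) : 2%:R^-1 * (a + - 'i%C * b) = 0 ->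
      2%:R^-1 * (a + 'i%C * b) = 0 -> a = 0 /\ b = 0.
    move=> E1 E2; have i0 : 'i%C != 0 :> R[i] by rewrite eq_complex /= oner_eq0 andbF.
    have a0 : a = 0.
      by rewrite -(addr0 0) -[X in X + _]E1 -E2; field.
    split=> //; move: E2; rewrite a0 add0r => /eqP.
    by rewrite !mulf_eq0 invr_eq0 pnatr_eq0 (negbTE i0) => /eqP.
  have [E1 E2] := aux _ _ H1 H2.
  by case: p H1 H2 E1 E2 => k [].
have E p w (Uw : U w) := csmooth_is_cd p SF Uw.
have DR p w : U w -> is_dd (fun z => complex.Re (F z)) (dir p) w 0.
  by move=> Uw; have [+ _] := E p w Uw; rewrite D.
have DI p w : U w -> is_dd (fun z => complex.Im (F z)) (dir p) w 0.
  by move=> Uw; have [_] := E p w Uw; rewrite D.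
by apply/eqP; rewrite eq_complex (const_siegel DR Uz) (const_siegel DI Uz) !eqxx.
Qed.

End Constancy.

(** * The constant vanishes *)

Section ConstantDefect.
Variables (R : realType) (m : nat).
Local Notation V := 'rV[R[i]]_m.+1.
Local Notation N := (@ord_max m).
Local Notation U := (siegel R m).
Local Notation oU := (@open_siegel R m).
Local Notation w0 := (siegel_base R m).
Implicit Types (w z : V).
Variables (kap : 'I_m.+1 -> V -> R[i]) (C : R[i]).
Hypothesis Hkap : forall k, hol U (kap k).
Hypothesis Skap : forall i j w, U w -> dz false i (kap j) w = dz false j (kap i) w.
Hypothesis Ckap : forall w, U w -> rhoC w * defect w (fun k => kap k w) = C.

Let eul z : R[i] := euler z (fun k => kap k z) - 1.

Lemma hol_eul : hol U eul.
Proof.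
apply: (holD oU); last exact: (hol_cst oU).
apply: (hol_sum oU) => j; apply: (holM oU); [exact: (hol_coord oU) | exact: Hkap].
Qed.

Let P k j := dz false k (kap j) w0.
Let x k := kap k w0.
Let Uw0 := siegel_base_in R m.

Lemma eul_base : eul w0 = x N - 1.
Proof.
rewrite /eul /euler (bigD1 N) //= siegel_baseE eqxx mul1r big1 ?addr0 // => j jN.
by rewrite siegel_baseE (negbTE jN) mul0r.
Qed.

Lemma dz_eul_base k : dz false k eul w0 = x k + P k N.
Proof.
have Sc j := csmooth_coord oU j.
have SE j := csmoothM oU (Sc j) (Hkap j).1.
rewrite /eul (dzD _ _ (csmooth_sum oU xpredT SE) (csmooth_cst oU (-1)) Uw0) dz_cst addr0.
rewrite (dz_sum oU _ _ _ SE Uw0).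
rewrite (eq_bigr (fun j => (k == j)%:R * x j + (N == j)%:R * P k j)) => [|j _].
  by rewrite big_split /= !sum_pick.
by rewrite (dzM _ _ (Sc j) (Hkap j).1 Uw0) dz_coord siegel_baseE [j == N]eq_sym.
Qed.

Lemma rhoC_base : rhoC w0 = 1.
Proof.
rewrite rhoCE /siegel_rho siegel_baseE eqxx big1 ?subr0 // => j jN.
by rewrite siegel_baseE (negbTE jN) /= expr0n addr0.
Qed.

Lemma drho_base k : drho w0 k = 2%:R^-1 * (k == N)%:R.
Proof.
rewrite /drho siegel_baseE; case: eqP => _; first by rewrite mulr1.
by rewrite cj0 oppr0 mulr0.
Qed.

(** At the base point, [D0] is the value of E, [D1 k] its derivative in w_k, and [D2 k l] its mixed
    derivative in w_k and the conjugate of w_l. *)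
Let D0 := \sum_(j < m.+1 | j != N) x j * cj (x j) +
  2%:R * (x N * cj (x N - 1) + (x N - 1) * cj (x N)).
Let D1 k := \sum_(j < m.+1 | j != N) P k j * cj (x j) +
  2%:R * (P k N * cj (x N - 1) + (x k + P k N) * cj (x N)).
Let D2 k l := \sum_(j < m.+1 | j != N) P k j * cj (P l j) +
  2%:R * (P k N * cj (x l + P l N) + (x k + P k N) * cj (P l N)).

(** At the base point rho is 1 and its differential has only the component along w_n, so the product
    rule for rho E = C is solved successively for the value, the first derivatives and the mixed
    derivative of E. *)
Lemma defect_jet k l : [/\ D0 = C, D1 k = - (2%:R^-1 * (k == N)%:R * C) &
  D2 k l = C * ((if k == N then 0 else (k == l)%:R) +
                2%:R^-1 * ((k == N)%:R * (l == N)%:R))].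
Proof.
have JD := jetD oU Uw0 (jet_sum oU Uw0 (fun j => j != N)
    (fun j => jet_sesqui oU k l Uw0 (Hkap j) (Hkap j)))
  (jetM oU Uw0 (jet_cst oU k l Uw0 2%:R) (jetD oU Uw0
    (jet_sesqui oU k l Uw0 (Hkap N) hol_eul) (jet_sesqui oU k l Uw0 hol_eul (Hkap N)))).
have J := jetM oU Uw0 (jet_rho k l Uw0) JD.
have [] := jet_eq_on oU Uw0 Ckap J (jet_cst oU k l Uw0 C).
rewrite !mul0r !add0r rhoC_base !mul1r !dz_eul_base eul_base !drho_base.
rewrite -!/(P _ _) -!/(x _) cjM cjV !cj_nat.
rewrite -/D0 -/(D1 k) -/(D2 k l).
set Db := \sum_(j < m.+1 | j != N) x j * cj (P l j) + _.
move=> E0 E1 E2 E3; split=> //.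
  by apply/eqP; rewrite -addr_eq0 addrC -E0 E1.
have {}E1 : D1 k = - (2%:R^-1 * (k == N)%:R * C).
  by apply/eqP; rewrite -addr_eq0 addrC -E0 E1.
have {}E2 : Db = - (2%:R^-1 * (l == N)%:R * C).
  by apply/eqP; rewrite -addr_eq0 addrC -E0 E2.
move: E3; rewrite E0 E1 E2.
move: (D2 k l) (k == N) (l == N) (k == l) => d [] [] [] /= E3; apply/eqP;
  rewrite -subr_eq0 -[X in _ == X]E3; apply/eqP; by field.
Qed.

Let B := \sum_(j < m.+1 | j != N) x j * cj (x j).

Lemma B_ge0 : 0 <= B.
Proof. by apply: sumr_ge0 => j _; rewrite mul_cj exprn_ge0. Qed.

Lemma conjB : cj B = B.
Proof.
by rewrite /B cj_sum; apply: eq_bigr => j _; rewrite cjM cjK mulrC.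
Qed.

Lemma conjC : cj C = C.
Proof.
have [<- _ _] := defect_jet N N.
by rewrite /D0 -/B !(cj_nat, cjD, cjM, cjN, cj1, cjK, conjB); ring.
Qed.

(* The direction in which the second order information is contracted: the
   gradient of the potential at the base point. *)
Let v j : R[i] := if j == N then 2%:R * (2%:R * cj (x N) - 1) else cj (x j).

Lemma P_sym j k : P j k = P k j. Proof. exact: (Skap _ _ Uw0). Qed.

(** Collecting the occurrences of [P] in [D1 k] gives exactly the coefficients [v], by symmetry of
    [P]; only a term in [x k] remains. *)
Lemma contract1 k : \sum_j v j * P j k =
  - (2%:R * cj (x N) * x k + 2%:R^-1 * (k == N)%:R * C).
Proof.
have [_ E _] := defect_jet k N.
have -> : \sum_j v j * P j k = D1 k - 2%:R * cj (x N) * x k.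
  rewrite (bigD1 N) //= /v eqxx /D1 (eq_bigr (fun j => P k j * cj (x j))) => [|j jN].
    by rewrite P_sym cjD cjN cj1; ring.
  by rewrite (negbTE jN) mulrC P_sym.
by rewrite E; ring.
Qed.

Lemma contract0 : \sum_j v j * x j = B + 2%:R * (2%:R * cj (x N) - 1) * x N.
Proof.
rewrite (bigD1 N) //= /v eqxx addrC; congr (_ + _).
by apply: eq_bigr => j jN; rewrite (negbTE jN) mulrC.
Qed.

Lemma sum_contract (F : 'I_m.+1 -> R[i]) (G : 'I_m.+1 -> R[i]) :
  \sum_k \sum_l v k * cj (v l) * (F k * cj (G l)) =
  (\sum_k v k * F k) * cj (\sum_l v l * G l).
Proof.
rewrite cj_sum mulr_suml; apply: eq_bigr => k _; rewrite mulr_sumr.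
by apply: eq_bigr => l _; rewrite cjM; ring.
Qed.

(** Every product in [D2] splits into a factor indexed by [k] and one indexed by [l], so after
    contraction [P] enters only through [q], which [contract1] determines. *)
Lemma contract2_lhs : let q k := \sum_j v j * P j k in
  let t := \sum_j v j * x j in
  \sum_k \sum_l v k * cj (v l) * D2 k l =
  \sum_(j < m.+1 | j != N) q j * cj (q j) +
  2%:R * (q N * cj (t + q N) + (t + q N) * cj (q N)).
Proof.
move=> q t.
have Et : t + q N = \sum_j v j * (x j + P j N).
  by rewrite -big_split; apply: eq_bigr => j _; rewrite mulrDr.
have E1 : \sum_(j < m.+1 | j != N) q j * cj (q j) =
    \sum_k \sum_l \sum_(j < m.+1 | j != N) v k * cj (v l) * (P k j * cj (P l j)).
  transitivity (\sum_(j < m.+1 | j != N)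
      \sum_k \sum_l v k * cj (v l) * (P k j * cj (P l j))).
    by apply: eq_bigr => j _; rewrite sum_contract.
  by rewrite exchange_big; apply: eq_bigr => k _; rewrite exchange_big.
rewrite E1 Et -!sum_contract -big_split /= mulr_sumr -big_split /=.
apply: eq_bigr => k _; rewrite -big_split /= mulr_sumr -big_split /=.
by apply: eq_bigr => l _; rewrite /D2 mulrDr mulr_sumr; congr (_ + _); ring.
Qed.

Lemma contract2_rhs : \sum_k \sum_l v k * cj (v l) * D2 k l =
  C * (B + 2%:R^-1 * (v N * cj (v N))).
Proof.
have E k l : v k * cj (v l) * D2 k l =
    (k == l)%:R * (v k * cj (v l) * C * (if k == N then 0 else 1)) +
    (N == l)%:R * (v k * cj (v l) * C * (2%:R^-1 * (N == k)%:R)).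
  have [_ _ ->] := defect_jet k l; rewrite ![N == _]eq_sym.
  by case: (k == N); case: (l == N); case: (k == l) => /=; ring.
rewrite (eq_bigr (fun k => v k * cj (v k) * C * (if k == N then 0 else 1) +
    (N == k)%:R * (v k * cj (v N) * C * 2%:R^-1))); last first.
  move=> k _; rewrite (eq_bigr _ (fun l _ => E k l)) big_split /= !sum_pick //.
  by congr (_ + _); ring.
rewrite big_split /= sum_pick // (bigD1 N) //= eqxx mulr0 add0r.
rewrite (eq_bigr (fun j => C * (x j * cj (x j)))) => [|j jN].
  by rewrite -mulr_sumr -/B; ring.
by rewrite (negbTE jN) /v (negbTE jN) cjK; ring.
Qed.

(** The contracted identity involves only [x N], its conjugate, [B] and [C]. Eliminating [B] through
    [D0] = C also cancels [x N] and leaves twice the claim. *)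
Lemma constant_defect_cases : C * (C + 1) = 0.
Proof.
have [E0 _ _] := defect_jet N N; rewrite /D0 -/B in E0.
have := contract2_lhs; rewrite /= contract2_rhs contract0 !contract1 eqxx.
rewrite (eq_bigr (fun j => 4%:R * x N * cj (x N) * (x j * cj (x j)))) => [|j jN].
  rewrite -mulr_sumr -/B /v eqxx.
  rewrite !(cj_nat, cjD, cjN, cjM, cjV, cj1, cjK, conjC, conjB) /=.
  rewrite cjD cjN cj1 in E0.
  move: E0; move: (x N) (cj (x N)) B C => a a' b c E0 E.
  have Eb : b = c - 2%:R * (a * (a' - 1) + (a - 1) * a') by rewrite -E0; ring.
  rewrite Eb in E; move/eqP: E; rewrite -subr_eq0 => /eqP E.
  have two : 2%:R != 0 :> R[i] by rewrite pnatr_eq0.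
  by apply: (mulfI two); rewrite mulr0 -[RHS]E; field.
rewrite contract1 (negbTE jN) mulr0 mul0r addr0.
by rewrite !(cj_nat, cjD, cjN, cjM, cjV, cj1, cjK); ring.
Qed.

(** C + 1 equals [B] plus the squared modulus of 2 x_N - 1, so C = -1 forces x_N = 1/2. Completing
    the square in [D2 N N] = -1/2 then leaves a positive remainder 1/4 in a sum of squares equal to
    zero. *)
Lemma constant_defect_eq0 : C = 0.
Proof.
have /eqP := constant_defect_cases; rewrite mulf_eq0 => /orP[/eqP //|].
rewrite addr_eq0 => /eqP C1; exfalso.
have [E0 _ E2] := defect_jet N N.
have xN : 2%:R * x N = 1.
  have E : B + (2%:R * x N - 1) * cj (2%:R * x N - 1) = 0.
    transitivity (C + 1); last by rewrite C1 addNr.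
    by rewrite -E0 /D0 -/B !(cj_nat, cjD, cjN, cjM, cj1); ring.
  move/eqP: E; rewrite paddr_eq0 ?B_ge0 //; last by rewrite mul_cj exprn_ge0.
  by rewrite mulf_eq0 cj_eq0 orbb subr_eq0 => /andP[_ /eqP].
have two : 2%:R != 0 :> R[i] by rewrite pnatr_eq0.
have {}xN : x N = 2%:R^-1 by apply: (mulfI two); rewrite xN divff.
move: E2; rewrite /D2 eqxx xN C1 add0r !mulr1 => E2.
set S := \sum_(j < m.+1 | j != N) _ in E2.
have S0 : 0 <= S by apply: sumr_ge0 => j _; rewrite mul_cj exprn_ge0.
have E : S + (2%:R * P N N + 2%:R^-1) * cj (2%:R * P N N + 2%:R^-1) + 4%:R^-1 = 0.
  move: E2; rewrite !(cj_nat, cjD, cjM, cjV).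
  move: (P N N) (cj (P N N)) S {S0} => p p' s E2.
  move/eqP: E2; rewrite -subr_eq0 => /eqP E2.
  rewrite -E2. by field.
have : 0 < S + (2%:R * P N N + 2%:R^-1) * cj (2%:R * P N N + 2%:R^-1) + 4%:R^-1.
  apply: ltr_wpDl; last by rewrite invr_gt0 ltr0n.
  by apply: addr_ge0 => //; rewrite mul_cj exprn_ge0.
by rewrite E ltxx.
Qed.

End ConstantDefect.

(** * Rigidity *)

Section CayleyCoordinates.
Variables (R : realType) (m : nat).
Local Notation V := 'rV[R[i]]_m.+1.
Local Notation N := (@ord_max m).
Implicit Types (z : V).

(* The Cayley transform to the unit ball is [z |-> cayley z / tcoord z]. *)
Definition tcoord z : R[i] := 2%:R^-1 * (z 0 N + 1).
Definition cayley z : V :=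
  \row_j (if j == N then 2%:R^-1 * (z 0 N - 1) else z 0 j).

(** The affine function l of the overview in homogeneous ball coordinates; it is the constant 1 for
    g = (0, .., 0, -1). *)
Definition ell (g : 'I_m.+1 -> R[i]) z : R[i] := tcoord z + \sum_j g j * cayley z 0 j.

(** Re w_n is the squared modulus of (w_n + 1)/2 minus that of (w_n - 1)/2. *)
Lemma rhoC_cayley z :
  rhoC z = tcoord z * cj (tcoord z) - \sum_j cayley z 0 j * cj (cayley z 0 j).
Proof.
rewrite [in RHS](bigD1 N) //= mxE eqxx /rhoC /tcoord.
rewrite (eq_bigr (fun j => cayley z 0 j * cj (cayley z 0 j))) => [|j jN].
  move: (\sum_(_ < _ | _) _) => S.
  by rewrite !(cj_nat, cjM, cjD, cjN, cjV, cj1); field.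
by rewrite mxE (negbTE jN).
Qed.

Definition dell (g : 'I_m.+1 -> R[i]) k : R[i] :=
  if k == N then 2%:R^-1 * (1 + g N) else g k.

Lemma ellE g z : ell g z = \sum_j dell g j * z 0 j + 2%:R^-1 * (1 - g N).
Proof.
rewrite /ell /tcoord (bigD1 N) //= [in RHS](bigD1 N) //= mxE /dell eqxx.
rewrite (eq_bigr (fun j => dell g j * z 0 j)) => [|j jN].
  rewrite [in RHS](eq_bigr (fun j => dell g j * z 0 j)) => [|j jN].
    move: (\sum_(_ < _ | _) _) => S.
    by field.
  by rewrite /dell (negbTE jN).
by rewrite mxE /dell (negbTE jN).
Qed.

End CayleyCoordinates.

Section Rigidity.
Variables (R : realType) (m : nat).
Local Notation V := 'rV[R[i]]_m.+1.
Local Notation N := (@ord_max m).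
Local Notation U := (siegel R m).
Local Notation oU := (@open_siegel R m).
Local Notation w0 := (siegel_base R m).
Implicit Types (w z : V).
Variables (kap : 'I_m.+1 -> V -> R[i]).
Hypothesis Hkap : forall k, hol U (kap k).
Hypothesis Ekap : forall w, U w -> defect w (fun k => kap k w) = 0.

Let eul z : R[i] := euler z (fun k => kap k z) - 1.
Let s z : R[i] := kap N z - eul z.
Let f j z : R[i] := if j == N then kap N z + eul z else kap j z.

(** Polarization: 4 Re (a conj e) = |a + e|^2 - |a - e|^2. *)
Lemma norm_balance w : U w -> \sum_j f j w * cj (f j w) = s w * cj (s w).
Proof.
move=> Uw; apply/eqP; rewrite -subr_eq0; apply/eqP.
apply: etrans (Ekap Uw); rewrite /defect -/(eul w).
rewrite (bigD1 N) //= /f eqxx /s.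
rewrite (eq_bigr (fun j => kap j w * cj (kap j w))) => [|j jN].
  move: (\sum_(_ < _ | _) _) (eul w) (kap N w) => S e a.
  by rewrite !(cjD, cjN); ring.
by rewrite (negbTE jN).
Qed.

(** At a zero of [s] all the [f j] vanish by [norm_balance], hence all the [kap j]; but then [eul]
    is -1 and [s] is 1. *)
Lemma s_neq0 w : U w -> s w != 0.
Proof.
move=> Uw; apply/eqP => s0; have := norm_balance Uw; rewrite s0 mul0r => /eqP.
rewrite psumr_eq0 => [/allP H|j _]; last by rewrite mul_cj exprn_ge0.
have f0 j : f j w = 0.
  have /implyP/(_ isT) := H j (mem_index_enum j).
  by rewrite mulf_eq0 cj_eq0 orbb => /eqP.
have two : 2%:R != 0 :> R[i] by rewrite pnatr_eq0.
have kN : kap N w = 0.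
  apply: (mulfI two); rewrite mulr0 -[RHS](addr0 0) -[X in X + _](f0 N) -s0.
  by rewrite /f eqxx /s; ring.
have k0 j : kap j w = 0.
  have [->//|jN] := eqVneq j N.
  by have := f0 j; rewrite /f (negbTE jN).
move: s0; rewrite /s /eul /euler kN big1 => [|j _]; last by rewrite k0 mulr0.
by rewrite !add0r opprK => /eqP; rewrite oner_eq0.
Qed.

Lemma hol_s : hol U s.
Proof.
have He := hol_eul Hkap.
have := holD oU (Hkap N) (holM oU (hol_cst oU (-1)) He).
by under eq_fun do rewrite mulN1r.
Qed.

Lemma hol_f j : hol U (f j).
Proof.
rewrite /f; case: (j == N); last exact: Hkap.
exact: (holD oU (Hkap N) (hol_eul Hkap)).
Qed.

(** Taking the mixed derivative of the constant sum of the |f_j / s|^2 gives a vanishing sum of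
    squared moduli of the derivatives of the ratios. *)
Lemma ratio_const j z : U z -> f j z / s z = f j w0 / s w0.
Proof.
have Hg i : hol U (fun z => f i z * (s z)^-1).
  exact: (holM oU (hol_f i) (holV oU hol_s s_neq0)).
have E w : U w -> \sum_j (f j w * (s w)^-1) * cj (f j w * (s w)^-1) = 1.
  move=> Uw; rewrite (eq_bigr (fun j => (s w * cj (s w))^-1 * (f j w * cj (f j w)))).
    by rewrite -mulr_sumr norm_balance // mulVf // mulf_neq0 ?cj_eq0 ?s_neq0.
  by move=> k _; rewrite cjM cjV invfM; ring.
apply: (csmooth_const (Hg j).1) => b k w Uw.
case: b; first exact: (Hg j).2.
have J := jet_sum oU Uw xpredT (fun j => jet_sesqui oU k k Uw (Hg j) (Hg j)).
have [_ _ _ /eqP] := jet_eq_on oU Uw E J (jet_cst oU k k Uw 1).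
rewrite psumr_eq0 => [/allP H|i _]; last by rewrite mul_cj exprn_ge0.
have /implyP/(_ isT) := H j (mem_index_enum j).
by rewrite mulf_eq0 cj_eq0 orbb => /eqP.
Qed.

(** Constancy of the ratios makes each [kap k] a constant multiple of [s]. Substituting this in the
    definition of [eul] gives s * ell g = 1, so 1 / s is affine. *)
Lemma log_derivative_affine : exists g : 'I_m.+1 -> R[i],
  [/\ \sum_j g j * cj (g j) = 1,
      forall w, U w -> ell g w != 0 &
      forall k w, U w -> kap k w = dell g k / ell g w].
Proof.
pose g j := f j w0 / s w0; have Uw0 := siegel_base_in R m.
have fE j w : U w -> f j w = g j * s w.
  by move=> Uw; rewrite /g -(ratio_const j Uw) divfK ?s_neq0.
have kE k w : U w -> kap k w = dell g k * s w.
  move=> Uw; rewrite /dell; case: eqVneq => [->|kN].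
    have -> : kap N w = 2%:R^-1 * (s w + f N w) by rewrite /f eqxx /s; field.
    by rewrite fE //; ring.
  by have := fE k w Uw; rewrite /f (negbTE kN).
have sE w : U w -> s w * ell g w = 1.
  move=> Uw; have eE : eul w = 2%:R^-1 * (f N w - s w) by rewrite /f eqxx /s; field.
  have : eul w + 1 = s w * \sum_j dell g j * w 0 j.
    rewrite /eul subrK /euler mulr_sumr; apply: eq_bigr => j _.
    by rewrite kE //; ring.
  move=> E; rewrite ellE mulrDr -E eE fE //.
  by move: (s w) (g N) => a b; field.
exists g; split=> [|w Uw|k w Uw].
- rewrite (eq_bigr (fun j => (s w0 * cj (s w0))^-1 * (f j w0 * cj (f j w0)))).
    by rewrite -mulr_sumr norm_balance // mulVf // mulf_neq0 ?cj_eq0 ?s_neq0.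
  by move=> j _; rewrite /g cjM cjV invfM; ring.
- by apply/eqP => l0; have /eqP := sE w Uw; rewrite l0 mulr0 eq_sym oner_eq0.
- have l0 : ell g w != 0.
    by apply/eqP => l0; have /eqP := sE w Uw; rewrite l0 mulr0 eq_sym oner_eq0.
  by rewrite kE //; congr (_ * _); apply: (mulIf l0); rewrite sE // mulVf.
Qed.

End Rigidity.

(** * Automorphisms fixing the base point *)

Section Unitary.
Variables (R : realType) (m : nat).
Local Notation N := (@ord_max m).
Local Notation adj A := (map_mx (@cj R) A^T).
Implicit Types (x : 'I_m.+1 -> R[i]).

Lemma unitary_isometry (A : 'M[R[i]]_m.+1) (y : 'rV[R[i]]_m.+1) : A *m adj A = 1%:M ->
  \sum_j (y *m A) 0 j * cj ((y *m A) 0 j) = \sum_j y 0 j * cj (y 0 j).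
Proof.
move=> AA.
have E (u : 'rV[R[i]]_m.+1) : \sum_j u 0 j * cj (u 0 j) = (u *m adj u) 0 0.
  by rewrite mxE; apply: eq_bigr => j _; rewrite !mxE.
rewrite !E; congr (_ 0 0).
have -> : adj (y *m A) = adj A *m adj y.
  apply/matrixP => i j; rewrite !mxE cj_sum; apply: eq_bigr => k _.
  by rewrite !mxE cjM mulrC.
by rewrite mulmxA -[y *m A *m _]mulmxA AA mulmx1.
Qed.

(* A Householder reflection, followed by multiplication by a phase. *)
Lemma unitary_last_column x : \sum_j x j * cj (x j) = 1 ->
  exists A : 'M[R[i]]_m.+1, (forall i, A i N = x i) /\ A *m adj A = 1%:M.
Proof.
move=> x1.
(* Polar form of the last entry, with phase 1 when that entry is zero. *)
have [t [p [tt p0 cp xN]]] : exists t p : R[i],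
    [/\ t * cj t = 1, 0 <= p, cj p = p & x N = t * p].
  have [x0|x0] := eqVneq (x N) 0.
    by exists 1, 0; rewrite cj1 cj0 mulr1 x0 mulr0.
  have nx0 : `|x N| != 0 by rewrite normr_eq0.
  have cn : cj `|x N| = `|x N| by rewrite normc_def cj_real.
  exists (x N / `|x N|), `|x N|; split; rewrite ?normr_ge0 ?divfK //.
  by rewrite cjM cjV cn mulrACA mul_cj -invfM -expr2 divff // expf_neq0.
(* The reflection is along y = e_N + conj t x, of squared length 2 q. It sends e_N to e_N - y = -
   conj t x, and the factor -t turns this into x. Since p >= 0, q is at least 1 and y is never
   zero. *)
pose q : R[i] := 1 + p.
have q0 : q != 0 by rewrite gt_eqF // ltr_wpDr.
have cq : cj q = q by rewrite cjD cj1 cp.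
pose y i : R[i] := (i == N)%:R + cj t * x i.
have yN : y N = q.
  by rewrite /y eqxx xN mulrA [cj t * t]mulrC tt mul1r.
have yy : \sum_j y j * cj (y j) = 2%:R * q.
  rewrite (eq_bigr (fun j => (N == j)%:R * (1 + t * cj (x j) + cj t * x j) +
      x j * cj (x j))) => [|j _].
    rewrite big_split /= sum_pick // x1 xN cjM cp mulrA tt mulrA [cj t * t]mulrC tt /q.
    by ring.
  rewrite /y cjD cj_nat cjM cjK [N == j]eq_sym -[x j * cj (x j)]mul1r -tt.
  by case: (j == N) => /=; ring.
pose H : 'M[R[i]]_m.+1 := \matrix_(i, j) ((i == j)%:R - y i * cj (y j) / q).
have HH : H *m H = 1%:M.
  apply/matrixP => i j; rewrite mxE [RHS]mxE.
  rewrite (eq_bigr (fun k => (i == k)%:R * ((k == j)%:R - y k * cj (y j) / q) -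
     (j == k)%:R * (y i * cj (y k) / q) +
     y i * cj (y j) / q ^+ 2 * (y k * cj (y k)))) => [|k _].
    rewrite big_split /= sumrB !sum_pick // -mulr_sumr yy.
    by move: q0; move: (q) (y i) (cj (y j)) => a b c a0; field.
  rewrite !mxE [j == k]eq_sym.
  by move: q0; move: (q) (y i) (cj (y j)) (y k) (cj (y k)) (i == k)%:R (k == j)%:R =>
    a b c d e b1 b2 a0; field.
have adjH : adj H = H.
  apply/matrixP => i j; rewrite !mxE cjD cj_nat cjN !cjM cjV cq cjK eq_sym.
  by rewrite [cj (y j) * _]mulrC.
exists (- t *: H); split=> [i|].
  rewrite !mxE yN cq mulfK // /y.
  by rewrite -[RHS]mul1r -tt; ring.
have -> : adj (- t *: H) = - cj t *: H.
  by rewrite -{2}adjH; apply/matrixP => i j; rewrite !mxE cjM cjN.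
by rewrite -scalemxAl -scalemxAr HH scalerA mulrNN tt scale1r.
Qed.

End Unitary.

Section Automorphism.
Variables (R : realType) (m : nat).
Local Notation V := 'rV[R[i]]_m.+1.
Local Notation N := (@ord_max m).
Local Notation U := (siegel R m).
Local Notation w0 := (siegel_base R m).
Local Notation adj A := (map_mx (@cj R) A^T).
Implicit Types (z : V) (A B : 'M[R[i]]_m.+1).

Definition auto_den A z : R[i] := tcoord z - (cayley z *m A) 0 N.

Definition auto_num A z : V :=
  \row_j ((cayley z *m A) 0 j + (if j == N then tcoord z else 0)).

(* The unitary map [y |-> y A] of the ball, in the coordinates of [siegel]. *)
Definition siegel_auto A z : V := (auto_den A z)^-1 *: auto_num A z.

Lemma siegel_autoE A z j : siegel_auto A z 0 j = (auto_den A z)^-1 *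
  ((cayley z *m A) 0 j + (if j == N then tcoord z else 0)).
Proof. by rewrite mxE; congr (_ * _); rewrite mxE. Qed.

Lemma cayleyE z j : cayley z 0 j = if j == N then 2%:R^-1 * (z 0 N - 1) else z 0 j.
Proof. by rewrite mxE. Qed.

Lemma tcoord_auto A z : auto_den A z != 0 ->
  tcoord (siegel_auto A z) = tcoord z / auto_den A z.
Proof.
rewrite {1}/tcoord siegel_autoE eqxx /auto_den.
by move: (tcoord z) ((cayley z *m A) 0 N) => t y d0; field.
Qed.

Lemma cayley_auto A z : auto_den A z != 0 ->
  cayley (siegel_auto A z) = (auto_den A z)^-1 *: (cayley z *m A).
Proof.
move=> d0; apply/rowP => j; rewrite cayleyE [RHS]mxE !siegel_autoE eqxx.
case: eqVneq => [->|jN]; last by rewrite addr0.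
move: d0; rewrite /auto_den.
by move: (tcoord z) ((cayley z *m A) 0 N) => t y d0; field.
Qed.

(** In the homogeneous coordinates [tcoord] and [cayley], rho is an indefinite hermitian form
    preserved by the unitary matrix; dividing the coordinates by [auto_den] divides rho by its
    squared modulus. *)
Lemma rhoC_auto A z : A *m adj A = 1%:M -> auto_den A z != 0 ->
  rhoC (siegel_auto A z) = rhoC z / (auto_den A z * cj (auto_den A z)).
Proof.
move=> AA d0; rewrite !rhoC_cayley tcoord_auto // cayley_auto //.
rewrite -(unitary_isometry (cayley z) AA) mulrBl; congr (_ - _).
  by rewrite cjM cjV invfM; ring.
rewrite mulr_suml; apply: eq_bigr => j _.
by rewrite [in LHS]mxE cjM cjV invfM; ring.
Qed.

(** At a zero, the square of [tcoord] would cancel the last square in [rhoC_cayley], leaving rho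
    equal to minus a sum of squares. *)
Lemma auto_den_neq0 A z : A *m adj A = 1%:M -> U z -> auto_den A z != 0.
Proof.
move=> AA Uz; apply/eqP => d0.
have : 0 < rhoC z by rewrite rhoCE ltcR.
rewrite rhoC_cayley -(unitary_isometry (cayley z) AA) (bigD1 N) //=.
move/eqP: d0; rewrite subr_eq0 => /eqP ->.
rewrite opprD addrA subrr add0r oppr_gt0 => H.
have : 0 <= \sum_(j < m.+1 | j != N) (cayley z *m A) 0 j * cj ((cayley z *m A) 0 j).
  by apply: sumr_ge0 => j _; rewrite mul_cj exprn_ge0.
by move=> H'; have := le_lt_trans H' H; rewrite ltxx.
Qed.

Lemma siegel_autoP A z : A *m adj A = 1%:M -> U z -> U (siegel_auto A z).
Proof.
move=> AA Uz; have d0 := auto_den_neq0 AA Uz.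
rewrite /siegel /= -ltcR -rhoCE rhoC_auto // divr_gt0 //.
  by rewrite rhoCE ltcR.
by rewrite mul_cj exprn_gt0 // normr_gt0.
Qed.

Lemma siegel_autoK A B z : A *m adj A = 1%:M -> A *m B = 1%:M -> U z ->
  siegel_auto B (siegel_auto A z) = z.
Proof.
move=> AA AB Uz; have d0 := auto_den_neq0 AA Uz.
have E : cayley (siegel_auto A z) *m B = (auto_den A z)^-1 *: cayley z.
  by rewrite cayley_auto // -scalemxAl -mulmxA AB mulmx1.
have Ed : auto_den B (siegel_auto A z) = (auto_den A z)^-1.
  rewrite {1}/auto_den E tcoord_auto // [X in _ - X]mxE cayleyE eqxx.
  by move: d0; move: (auto_den A z) => d d0; rewrite /tcoord; field.
apply/rowP => j; rewrite siegel_autoE Ed invrK E tcoord_auto //.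
rewrite [X in _ * (X + _)]mxE cayleyE.
case: eqVneq => [->|jN]; last by rewrite addr0 mulrA divff // mul1r.
by move: d0; move: (auto_den A z) => d d0; rewrite /tcoord; field.
Qed.

(** The base point corresponds to the centre of the ball, which every linear map fixes. *)
Lemma siegel_auto_base A : siegel_auto A w0 = w0.
Proof.
have c0 : cayley w0 = 0.
  apply/rowP => j; rewrite cayleyE !siegel_baseE eqxx subrr mulr0 mxE.
  by case: eqVneq.
have t0 : tcoord w0 = 1 by rewrite /tcoord siegel_baseE eqxx /=; field.
apply/rowP => j; rewrite siegel_autoE /auto_den c0 mul0mx t0 !mxE subr0 invr1 mul1r.
by rewrite add0r eqxx; case: (j == N).
Qed.

Lemma differentiable_affine (a : 'I_m.+1 -> R[i]) (b : R[i]) z :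
  differentiable (fun z : V => \sum_j a j * z 0 j + b) z.
Proof.
apply: (@differentiableD _ _ _ (fun z : V => \sum_j a j * z 0 j) (cst b)) => //.
have -> : (fun z : V => \sum_j a j * z 0 j) =
    \sum_(j < m.+1) (fun z : V => a j * z 0 j).
  by apply/funext => u; rewrite fct_sumE.
apply: differentiable_sum => j.
apply: (@differentiableM _ _ (cst (a j)) (fun z : V => z 0 j)) => //.
exact: differentiable_coord.
Qed.

Lemma cayley_mulE A z j : (cayley z *m A) 0 j =
  \sum_k (if k == N then 2%:R^-1 * A N j else A k j) * z 0 k - 2%:R^-1 * A N j.
Proof.
rewrite mxE (bigD1 N) //= [in RHS](bigD1 N) //= mxE eqxx.
rewrite (eq_bigr (fun k => (if k == N then 2%:R^-1 * A N j else A k j) * z 0 k)) => [|k kN].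
  by move: (\sum_(_ < _ | _) _) => S; ring.
by rewrite mxE (negbTE kN) mulrC.
Qed.

Lemma siegel_auto_holomorphic A : A *m adj A = 1%:M ->
  holomorphic_on U (siegel_auto A).
Proof.
move=> AA z Uz; have d0 := auto_den_neq0 AA Uz.
have Dd : differentiable (auto_den A) z.
  pose a k := (if k == N then 2%:R^-1 else 0) -
    (if k == N then 2%:R^-1 * A N N else A k N).
  have -> : auto_den A = fun z => \sum_j a j * z 0 j + (2%:R^-1 + 2%:R^-1 * A N N).
    apply/funext => u; rewrite /auto_den cayley_mulE.
    rewrite [in RHS](eq_bigr (fun j => (N == j)%:R * (2%:R^-1 * u 0 j) -
        (if j == N then 2%:R^-1 * A N N else A j N) * u 0 j)) => [|j _].
      rewrite sumrB sum_pick // /tcoord.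
      by move: (\sum_(_ < _) _) => S; ring.
    by rewrite /a [N == j]eq_sym; case: (j == N) => /=; ring.
  exact: differentiable_affine.
have DV : differentiable (fun z => (auto_den A z)^-1) z by exact: differentiableV.
have Dn j : differentiable (fun z => auto_num A z 0 j) z.
  pose a k := (if k == N then 2%:R^-1 * A N j else A k j) +
    (if k == N then (if j == N then 2%:R^-1 else 0) else 0).
  have -> : (fun z => auto_num A z 0 j) = fun z => \sum_k a k * z 0 k +
     ((if j == N then 2%:R^-1 else 0) - 2%:R^-1 * A N j).
    apply/funext => u; rewrite mxE cayley_mulE.
    rewrite [in RHS](eq_bigr (fun k => (N == k)%:R *
        ((if j == N then 2%:R^-1 else 0) * u 0 k) +
        (if k == N then 2%:R^-1 * A N j else A k j) * u 0 k)) => [|k _].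
      rewrite big_split /= sum_pick // /tcoord.
      by move: (\sum_(_ < _) _) => S; case: (j == N); ring.
    by rewrite /a [N == k]eq_sym; case: (k == N); case: (j == N) => /=; ring.
  exact: differentiable_affine.
have -> : siegel_auto A = \sum_(j < m.+1)
    (fun z : V => ((auto_den A z)^-1 * auto_num A z 0 j) *: (delta_mx 0 j : V)).
  apply/funext => u; rewrite fct_sumE [LHS]row_sum_delta.
  by apply: eq_bigr => j _; rewrite mxE.
apply: differentiable_sum => j; apply: differentiableZl.
exact: (differentiableM DV (Dn j)).
Qed.

Lemma siegel_auto_automorphism A : A *m adj A = 1%:M ->
  holomorphic_automorphism U (siegel_auto A).
Proof.
move=> AA; have BA := mulmx1C AA.
have BB : adj A *m adj (adj A) = 1%:M.
  have -> : adj (adj A) = A by apply/matrixP => i j; rewrite !mxE cjK.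
  exact: BA.
split; first exact: siegel_auto_holomorphic.
- by move=> w; exact: siegel_autoP.
exists (siegel_auto (adj A)); split; first exact: siegel_auto_holomorphic.
- by move=> w; exact: siegel_autoP.
- by move=> w; exact: siegel_autoK.
- by move=> w; exact: siegel_autoK.
Qed.

End Automorphism.

(** * Recovering the potential from its affine function *)

Section AffineModulus.
Variables (R : realType) (m : nat).
Local Notation V := 'rV[R[i]]_m.+1.
Local Notation N := (@ord_max m).
Local Notation U := (siegel R m).
Local Notation oU := (@open_siegel R m).
Local Notation w0 := (siegel_base R m).
Local Notation c := (m.+2%:R : R[i]).
Implicit Types (z : V).
Variable g : 'I_m.+1 -> R[i].
Hypothesis g0 : forall z, U z -> ell g z != 0.

Lemma hol_ell : hol U (ell g).
Proof.
have -> : ell g = fun z => \sum_j dell g j * z 0 j + 2%:R^-1 * (1 - g N).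
  by apply/funext => z; exact: ellE.
apply: (holD oU); last exact: (hol_cst oU).
by apply: (hol_sum oU) => j; apply: (holM oU); [exact: (hol_cst oU) | exact: (hol_coord oU)].
Qed.

Lemma dz_ell k z : U z -> dz false k (ell g) z = dell g k.
Proof.
move=> Uz.
have -> : ell g = fun z => \sum_j dell g j * z 0 j + 2%:R^-1 * (1 - g N).
  by apply/funext => u; exact: ellE.
have Sj j := csmoothZ oU (dell g j) (csmooth_coord oU j).
rewrite (dzD _ _ (csmooth_sum oU xpredT Sj) (csmooth_cst oU _) Uz) dz_cst addr0.
rewrite (dz_sum oU _ _ _ Sj Uz) (eq_bigr (fun j => (k == j)%:R * dell g j)) => [|j _].
  by rewrite sum_pick.
by rewrite (dzZ oU _ _ _ (csmooth_coord oU j) Uz) dz_coord mulrC.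
Qed.

Definition ell2 z : R := complex.Re (ell g z * cj (ell g z)).

Lemma ell2E z : (ell2 z)%:C = ell g z * cj (ell g z).
Proof. by rewrite /ell2 mul_cj normc_def -rmorphXn. Qed.

Lemma ell2_gt0 z : U z -> 0 < ell2 z.
Proof. by move=> Uz; rewrite -ltcR ell2E mul_cj exprn_gt0 // normr_gt0 g0. Qed.

Lemma csmooth_ell2 : csmooth U (fun z => ell g z * cj (ell g z)).
Proof. exact: (csmoothM oU hol_ell.1 (csmooth_conj oU hol_ell.1)). Qed.

Lemma dz_ln_ell2 k z : U z ->
  dz false k (fun z => (ln (ell2 z))%:C) z = dell g k / ell g z.
Proof.
move=> Uz; rewrite (dz_ln _ _ csmooth_ell2.1 ell2_gt0 Uz).
have -> : (fun z => (ell2 z)%:C) = fun z => ell g z * cj (ell g z).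
  by apply/funext => u; exact: ell2E.
have [_ [_ -> _ _]] := jet_sesqui oU k k Uz hol_ell hol_ell.
rewrite dz_ell // ell2E; field.
by rewrite g0 // cj_eq0 g0.
Qed.

(** The difference [F] between [phi] and the candidate is real with vanishing Wirtinger derivatives,
    hence constant by [real_partial0] and [const_siegel]. *)
Lemma potential_ell phi : smooth_on U phi ->
  (forall k z, U z -> hpart phi k z = dell g k / ell g z) ->
  exists t : R, forall z, U z ->
    phi z = t - m.+2%:R * (ln (siegel_rho z) - ln (ell2 z)).
Proof.
move=> Sphi Hphi.
pose F z : R := phi z + (m.+2%:R * ln (siegel_rho z) + - m.+2%:R * ln (ell2 z)).
have Slq := smooth_ln oU csmooth_ell2.1 ell2_gt0.
have SF : smooth_on U F.
  have Slr := smooth_ln oU (smooth_rho oU) (@siegel_rho_gt0 R m).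
  apply: (smooth_gen_smooth oU); apply: (SgD (SgSmooth Sphi)).
  exact: (SgD (SgM (SgCst U _) (SgSmooth Slr)) (SgM (SgCst U _) (SgSmooth Slq))).
have FE : (fun z => (F z)%:C) = fun z =>
    ((phi z)%:C + c * (ln (siegel_rho z))%:C) + - c * (ln (ell2 z))%:C.
  apply/funext => z; rewrite /F !rmorphD !rmorphM /= rmorphN !rmorph_nat.
  by rewrite addrA.
have c0 : c != 0 by rewrite pnatr_eq0.
have dF k z : U z -> dz false k (fun z => (F z)%:C) z = 0.
  move=> Uz; rewrite FE.
  have Slq' := csmooth_real oU Slq.
  rewrite (dzD _ _ (csmooth_pot Sphi) (csmoothZ oU (- c) Slq') Uz).
  rewrite (dzZ oU _ _ _ Slq' Uz) dz_ln_ell2 // -Hphi // /hpart.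
  by rewrite mulNr mulVKf // subrr.
exists (F w0) => z Uz.
have -> : F w0 = F z.
  apply/esym/const_siegel => // p w Uw.
  exact: (real_partial0 SF (dF p.1 w Uw) Uw).
by rewrite /F; ring.
Qed.

End AffineModulus.

(** * The potential as a pullback of the canonical one *)

Unset Implicit Arguments.

Theorem theorem1p1 (R : realType) (m : nat) (psi : 'rV[R[i]]_m.+1 -> R)
    (psi_gt0 : forall w, siegel R m w -> 0 < psi w)
    (psi_smooth : smooth_on (siegel R m) psi)
    (psi_potential : kahler_potential (siegel R m) (@siegel_metric R m)
                       (fun w => ln (psi w)))
    (psi_const : exists c : R, forall w, siegel R m w ->
       dnorm (@siegel_metric R m) (fun z => ln (psi z)) w = c%:C) :
  exists (sigma : 'rV[R[i]]_m.+1 -> 'rV[R[i]]_m.+1) (r : R),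
    [/\ holomorphic_automorphism (siegel R m) sigma,
        sigma (siegel_base R m) = siegel_base R m,
        0 < r &
        forall w, siegel R m w -> psi w = r * psi0 (sigma w)].
Proof.
have oU := @open_siegel R m.
pose phi w := ln (psi w).
have Sphi : smooth_on (siegel R m) phi by exact: (smooth_ln oU psi_smooth psi_gt0).
have Hhol k := hol_hpart k Sphi psi_potential.
have [c0 Hc] := psi_const.
(* The value of rho E obtained by solving c0^2 = (m + 2) (1 + rho E), which is [dnorm2E] for a
   gradient of length c0. *)
pose C : R[i] := c0%:C ^+ 2 / m.+2%:R - 1.
have n0 : m.+2%:R != 0 :> R[i] by rewrite pnatr_eq0.
have HC w : siegel R m w -> rhoC w * defect w (fun k => hpart phi k w) = C.
  move=> Uw; have := dnorm2E Sphi Uw.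
  rewrite -[LHS]sqrtCK -/(dnorm _ _ _) Hc // /C => ->.
  by rewrite mulrAC divff // mul1r addrAC subrr add0r.
have Hsym i j w := @hpart_sym R m phi i j w Sphi.
have C0 := constant_defect_eq0 Hhol Hsym HC.
have E0 w : siegel R m w -> defect w (fun k => hpart phi k w) = 0.
  move=> Uw; have /eqP := HC w Uw; rewrite C0 mulf_eq0.
  by rewrite (negbTE (rhoC_neq0 Uw)) => /eqP.
have [g [g1 l0 Hg]] := log_derivative_affine Hhol E0.
(* The sign makes [auto_den A] equal to [ell g]: the map of the ball sends the boundary zero -conj g
   of [ell g] to the image of infinity. *)
have [A [AN AA]] : exists A : 'M[R[i]]_m.+1, (forall i, A i ord_max = - g i) /\
    A *m map_mx (@cj R) A^T = 1%:M.
  apply: unitary_last_column; rewrite -[RHS]g1; apply: eq_bigr => j _.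
  by rewrite cjN mulrNN.
have dE w : auto_den A w = ell g w.
  rewrite /auto_den /ell mxE -sumrN; congr (_ + _); apply: eq_bigr => j _.
  by rewrite AN mulrN opprK mulrC.
have [t Ht] := potential_ell l0 Sphi Hg.
exists (siegel_auto A), (expR t); split.
- exact: siegel_auto_automorphism.
- exact: siegel_auto_base.
- exact: expR_gt0.
move=> w Uw; have Usw := siegel_autoP AA Uw.
have rE : siegel_rho (siegel_auto A w) = siegel_rho w / ell2 g w.
  apply: complexI; rewrite -rhoCE rhoC_auto ?auto_den_neq0 // rhoCE dE -ell2E.
  by rewrite fmorph_div.
have p0 : 0 < psi0 (siegel_auto A w) by rewrite /psi0 invr_gt0 exprn_gt0.
apply: ln_inj; rewrite ?posrE ?psi_gt0 ?mulr_gt0 ?expR_gt0 //.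
rewrite lnM ?posrE ?expR_gt0 // expRK ln_psi0 // rE.
have q0 := ell2_gt0 l0 Uw.
rewrite lnM ?posrE ?invr_gt0 // lnV ?posrE //.
by rewrite [LHS]Ht //; ring.
Qed.
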